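(* Let $d\ge 2$ and let $F$ be a (non-degenerate) probability distribution on $[0,\infty)$ satisfying $$\int_0^\infty \bigl(1-F(\sqrt{x})\bigr)^{1/d}\,dx<\infty .$$ Consider dynamic last-passage percolation on $V=[0,n]^d\cap\mathbb{Z}^d$ with weight distribution $F$, with passage times $T_t$ and geodesic vertex sets $\pi_t$, $t\in[0,1]$, and write $T=T_0$. There exists a constant $C<\infty$ such that for all integers $n\ge 1$ and all $0<\alpha<\frac{n}{\mathrm{Var}(T)}$ the following two statements hold. (i) (Stability) For all $t\in[0,1]$ with $t\le \alpha\frac1n\mathrm{Var}(T)$, $$\mathrm{Corr}(T_0,T_t)\ge 1-C\alpha .$$ (ii) (Chaos) If, in addition, there exists $c>0$ such that $\mathrm{Var}(\tilde\omega\mid \tilde\omega>k)>c$ for all $k\ge 0$, where $\tilde\omega$ is a random variable with distribution $F$, then for all $t\in[0,1]$ with $t\ge\alpha\frac1n\mathrm{Var}(T)$, $$\mathbb{E}\bigl[|\pi_0\cap\pi_t|\bigr]\le C\,\frac{n}{\alpha}.$$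
   Context: We identify $F$ with its distribution function, $F(x)=\mathbb{P}(\tilde\omega\le x)$. For an integer $n\ge1$ let $V=[0,n]^d\cap\mathbb{Z}^d$. Let $\Gamma$ be the set of all directed nearest-neighbour paths (regarded as their sets of vertices) from $(0,\dots,0)$ to $(n,\dots,n)$ each of whose steps is one of the $d$ coordinate vectors $(1,0,\dots,0),\dots,(0,\dots,0,1)$. For $\omega=(\omega_v)_{v\in V}\in[0,\infty)^V$ the passage time is $$T(\omega)=\max_{\gamma\in\Gamma}\sum_{v\in\gamma}\omega_v,$$ where the sum is over all vertices of $\gamma$, including both endpoints. A geodesic is any path in $\Gamma$ attaining the maximum. Dynamics: let $\omega=(\omega_v)_{v\in V}$ and $\omega'=(\omega'_v)_{v\in V}$ be independent families of i.i.d. random variables with distribution $F$, and let $(U_v)_{v\in V}$ be i.i.d. uniform on $[0,1]$, independent of $(\omega,\omega')$. For $t\in[0,1]$ set $\omega_v(t)=\omega_v$ if $U_v>t$ and $\omega_v(t)=\omega'_v$ if $U_v\le t$. Then $T_t:=T(\omega(t))$, and $\pi_t$ is the set of vertices contained in at least one geodesic for $T_t$, i.e. the union of all geodesics with respect to $\omega(t)$. All these objects depend on $n$. $|\cdot|$ denotes cardinality and $\mathrm{Corr}$ the correlation coefficient. The constant $C$ may depend on $d$ and $F$ (and hence on $c$), but not on $n$, $\alpha$ or $t$. Non-degenerate means $F$ is not a point mass, so that $\mathrm{Var}(T)>0$ and the expressions $n/\mathrm{Var}(T)$ and $\mathrm{Corr}(T_0,T_t)$ make sense. The additional condition in (ii)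 is understood to include $\mathbb{P}(\tilde\omega>k)>0$ for all $k\ge0$, so that the conditional variance is defined. *)

(* Defs.v *)
From HB Require Import structures.
From mathcomp Require Import all_boot all_order all_algebra.
From mathcomp Require Import all_classical all_reals all_analysis.

Set Implicit Arguments.
Unset Strict Implicit.
Unset Printing Implicit Defensive.

Import Order.TTheory GRing.Theory Num.Theory.
Import numFieldNormedType.Exports.

Local Open Scope classical_set_scope.
Local Open Scope ring_scope.

Notation site d n := {ffun 'I_d -> 'I_n.+1}.

Section LastPassage.
Context {R : realType} {d n : nat}.
Implicit Types (v : site d n) (g : {set site d n}) (w : site d n -> R).

Definition origin : site d n := [ffun=> ord0].
Definition far_corner : site d n := [ffun=> ord_max].

Definition unit_step : rel (site d n) := fun v v' =>
  [exists i, [forall j, (v' j == v j + (j == i) :> nat)%N]].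

(* A path is identified with its set of vertices. *)
Definition directed_paths : {set {set site d n}} :=
  [set g : {set site d n} | `[< exists s : seq (site d n),
     [/\ path unit_step origin s,
         last origin s = far_corner &
         g =i origin :: s] >] ]%SET.

Definition path_weight w g : R := \sum_(v in g) w v.

(* The default value 0 of the maximum is harmless: weights are nonnegative,
   and there is at least one directed path. *)
Definition passage_time w : R :=
  \big[Num.max/0]_(g in directed_paths) path_weight w g.

Definition geodesic w g : bool :=
  (g \in directed_paths) && (path_weight w g == passage_time w).

Definition geodesic_sites w : {set site d n} :=
  [set v | [exists g : {set site d n}, geodesic w g && (v \in g)]]%SET.

End LastPassage.

Section Probability.
Context {disp : measure_display} {Omega : measurableType disp} {R : realType}.
Variable P : probability Omega R.

Definition has_law (X : {RV P >-> R}) (mu : probability (measurableTypeR R) R) :=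
  forall A : set R, measurable A -> distribution P X A = mu A.

Definition mutually_independent (I : finType) (X : I -> {RV P >-> R}) :=
  forall (J : {set I}) (A : I -> set R),
    (forall i, i \in J -> measurable (A i)) ->
    P (\bigcap_(i in [set` J]) (X i @^-1` A i)) =
    (\prod_(i in J) P (X i @^-1` A i))%E.

Definition correlation (X Y : Omega -> R) : R :=
  fine (covariance P X Y)
    / (Num.sqrt (fine 'V_P[X]) * Num.sqrt (fine 'V_P[Y])).

End Probability.

Section Distribution.
Context {R : realType}.
Variable F : probability (measurableTypeR R) R.

Definition distribution_function (x : R) : R := fine (F `]-oo, x]%classic).

(* The law of a variable of distribution F conditioned to exceed k; it is the
   intended one only if F `]k, +oo[ > 0 (otherwise mnormalize returns F). *)
Definition law_above (k : R) : probability (measurableTypeR R) R :=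
  mnormalize (mrestr F (measurable_itv `]k, +oo[)) F.

Definition variance_above (k : R) : \bar R := ('V_(law_above k)[idfun])%E.

End Distribution.

Section Dynamics.
Context {disp : measure_display} {Omega : measurableType disp} {R : realType}
  {P : probability Omega R} {d n : nat}.
Variables omega omega' U : site d n -> {RV P >-> R}.

(* The independence of all the variables together is that the omega v are
   independent, likewise the omega' v and the U v, and that the three families
   are independent of each other. *)
Definition dynamic_environment (F : probability (measurableTypeR R) R) :=
  [/\ forall v, has_law (omega v) F,
      forall v, has_law (omega' v) F,
      forall v, has_law (U v) (uniform_prob (@ltr01 R)) &
      mutually_independent (fun i : site d n + site d n + site d n =>
        match i with
        | inl (inl v) => omega v
        | inl (inr v) => omega' v
        | inr v => U v
        end)].

Definition weights_at (t : R) (x : Omega) (v : site d n) : R :=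
  if t < U v x then omega v x else omega' v x.

Definition passage_time_at (t : R) (x : Omega) : R :=
  passage_time (weights_at t x).

Definition geodesic_sites_at (t : R) (x : Omega) : {set site d n} :=
  geodesic_sites (weights_at t x).

End Dynamics.

(* Main.v *)
Require Import Defs.
From HB Require Import structures.
From mathcomp Require Import all_boot all_order all_algebra.
From mathcomp Require Import all_classical all_reals all_analysis.
From mathcomp Require Import measurable_realfun zify ring lra.

(** E[T_0 T_t] is the mean of q(A) over the set A of sites whose clock has rung by
time t, where q(A) = E[T(z) T(z^A)] and z^A exchanges the two copies of the
weights on A.  With any function h of the old weights in place of T, q is
nonnegative because the two factors are conditionally independent copies, and

  q(A) - q(A + v) = 1/2 E[(D_v h)(z) (D_v h)(z^A)],  D_v h (z) = h(z) - h(z^v),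

so that q is decreasing and, applied to D_v h, convex along chains of sets.
Hence Var(T) - Cov(T_0, T_t) is at most t/2 times the sum of the influences
E[(D_v T)^2], and Var(T) is at least t/2 times the mean of the sum over v of
E[D_v T (z) D_v T (z^(A - v))].

Stability: the sum of the influences is at most a constant times the mean
passage time for the squared weights.  That mean is at most C n: the squared
weights are dominated by a sum of indicators, and for Bernoulli weights of
parameter p the mean of 2^T is bounded by counting the chains of sites that are
contained in the open set, which gives C n p^(1/d).

Chaos: as a function of the weight x at v, T = max(a, b + x), and v is on a
geodesic when x >= a - b.  Thus the products of increments dominate
((x - m)_+ - (y - m)_+)^2 with m the larger of the two thresholds, and the lower
bound on the conditional variances bounds the mean of this square below by a
constant times the probability that v is on geodesics of both z and z^A. *)

Set Implicit Arguments.
Unset Strict Implicit.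
Unset Printing Implicit Defensive.

Import Order.TTheory GRing.Theory Num.Theory.
Import numFieldNormedType.Exports.

Local Open Scope classical_set_scope.
Local Open Scope ring_scope.

Section ProductLaw.
Context {R : realType} {I : finType}.
Implicit Types (A : I -> set R) (mu : I -> probability (measurableTypeR R) R).

Definition rectangle A : set (I -> R) := [set z | forall i, A i (z i)].

Definition rectangles : set (set (I -> R)) :=
  [set rectangle A | A in [set A | forall i, measurable (A i)]].

Definition config := g_sigma_algebraType rectangles.

Lemma rectangleE A : rectangle A = \bigcap_(i in [set: I]) [set z | A i (z i)].
Proof. by apply/seteqP; split => [z zA i _|z zA i]; apply: zA. Qed.

Lemma measurable_rectangle A : (forall i, measurable (A i)) ->
  measurable (rectangle A : set config).
Proof. by move=> mA; apply: sub_sigma_algebra; exists A. Qed.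

Lemma measurable_coord i : measurable_fun [set: config] (fun z : config => z i).
Proof.
move=> _ B mB; rewrite setTI.
pose A j := if j == i then B else [set: R].
have -> : (fun z : config => z i) @^-1` B = rectangle A.
  apply/seteqP; split => [z /= zB j|z /(_ i)]; last by rewrite /A eqxx.
  by rewrite /A; case: eqP => // ->.
by apply: measurable_rectangle => j; rewrite /A; case: eqP.
Qed.

Lemma measurable_config d (T : measurableType d) (f : T -> config) :
  (forall i, measurable_fun [set: T] (fun x => f x i)) ->
  measurable_fun [set: T] f.
Proof.
move=> mf; apply: (@measurability _ _ _ config _ f rectangles) => //.
move=> _ [_ [A mA <-] <-]; rewrite setTI.
have -> : f @^-1` rectangle A = \bigcap_(i in [set: I]) ((fun x => f x i) @^-1` A i).
  by apply/seteqP; split => [z zA i _|z zA i]; apply: zA.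
apply: fin_bigcap_measurable => [|i _]; first exact: finite_finset.
by rewrite -[X in measurable X]setTI; apply: mf => //; apply: mA.
Qed.

Lemma setI_closed_rectangles : setI_closed rectangles.
Proof.
move=> _ _ [A mA <-] [B mB <-]; exists (fun i => A i `&` B i).
  by move=> i; apply: measurableI; [apply: mA|apply: mB].
by apply/seteqP; split => [z zAB|z [zA zB] i]; [split=> i; case: (zAB i)|split].
Qed.

Definition product_law (nu : {measure set config -> \bar R}) mu :=
  forall A, (forall i, measurable (A i)) ->
  nu (rectangle A) = (\prod_i mu i (A i))%E.

Lemma product_law_unique (nu1 nu2 : probability config R) mu :
  product_law nu1 mu -> product_law nu2 mu ->
  forall B, measurable B -> nu1 B = nu2 B.
Proof.
move=> h1 h2 B mB.
apply: (@measure_unique _ R config rectangles (fun=> setT) _ _ _ _ nu1 nu2) => //.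
- exact: setI_closed_rectangles.
- by move=> _; exists (fun=> setT) => //; rewrite rectangleE bigcapT.
- by rewrite bigcup_const.
- by move=> _ [A mA <-]; rewrite h1// h2.
- by move=> _; rewrite (le_lt_trans (probability_le1 _ _)) ?ltry.
Qed.

End ProductLaw.
Arguments config : clear implicits.

Section Laws.
Context {R : realType} {I : finType}.
Variable mu : I -> probability (measurableTypeR R) R.
Local Notation config := (config R I).

Definition has_product_law d (T : measurableType d) (P : {measure set T -> \bar R})
    (phi : T -> config) :=
  measurable_fun [set: T] phi /\
  forall A : I -> set R, (forall i, measurable (A i)) ->
    P (phi @^-1` rectangle A) = (\prod_i mu i (A i))%E.

Definition merge (K : {set I}) (x y : config) : config :=
  fun i => if i \in K then y i else x i.

Definition reindex_config (sigma : I -> I) (z : config) : config := z \o sigma.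

Lemma measurable_reindex sigma :
  measurable_fun [set: config] (reindex_config sigma).
Proof. by apply: measurable_config => i; apply: measurable_coord. Qed.

Lemma measurable_merge K :
  measurable_fun [set: config * config] (fun p => merge K p.1 p.2).
Proof.
apply: measurable_config => i; rewrite /merge; case: (i \in K).
- by apply: (measurableT_comp (measurable_coord i)).
- by apply: (measurableT_comp (measurable_coord i)).
Qed.

Lemma measurable_mergel K x : measurable_fun [set: config] (merge K x).
Proof.
apply: measurable_config => i; rewrite /merge; case: (i \in K) => //.
exact: measurable_coord.
Qed.

Variable nu : probability config R.
Hypothesis nuE : product_law nu mu.

Section Transfer.
Context d (T : measurableType d) (P : probability T R) (phi : T -> config).
Hypothesis law_phi : has_product_law P phi.

Let mphi : measurable_fun [set: T] phi := law_phi.1.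

Let phim : {mfun T >-> config} :=
  HB.pack phi (isMeasurableFun.Build _ _ _ _ phi mphi).

Lemma law_measure B : measurable B -> nu B = P (phi @^-1` B).
Proof.
move=> mB; rewrite (@product_law_unique _ _ nu (distribution P phim) mu)//.
by case: law_phi.
Qed.

Local Open Scope ereal_scope.

Lemma ge0_integral_law (h : config -> \bar R) :
  measurable_fun [set: config] h -> (forall z, 0 <= h z) ->
  \int[nu]_z h z = \int[P]_x h (phi x).
Proof.
move=> mh h0; rewrite (eq_measure_integral (distribution P phim)) => [|B mB _].
  by rewrite ge0_integral_distribution.
exact: law_measure.
Qed.

Lemma integrable_law (h : config -> \bar R) :
  nu.-integrable [set: config] h -> P.-integrable [set: T] (h \o phi).
Proof.
move=> /integrableP[mh hoo]; apply/integrableP; split.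
  exact: measurableT_comp.
rewrite -(ge0_integral_law (h := abse \o h))//.
  exact: measurableT_comp.
by move=> z; apply: abse_ge0.
Qed.

Lemma integral_law (h : config -> \bar R) :
  nu.-integrable [set: config] h -> \int[nu]_z h z = \int[P]_x h (phi x).
Proof.
move=> hi; rewrite (eq_measure_integral (distribution P phim)) => [|B mB _].
  rewrite integral_distribution//; last exact: integrable_law.
  exact: measurable_int hi.
exact: law_measure.
Qed.

End Transfer.

Lemma law_merge K : has_product_law (nu \x nu)%E (fun p => merge K p.1 p.2).
Proof.
split; first exact: measurable_merge.
move=> A mA.
pose B i := if i \in K then setT else A i.
pose C i := if i \in K then A i else setT.
have -> : (fun p : config * config => merge K p.1 p.2) @^-1` rectangle A =
    (rectangle B `*` rectangle C).
  apply/seteqP; split => [[x y] /= xyA|[x y] /= [xB yC] i].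
    by split => i /=; move: (xyA i); rewrite /merge /B /C; case: ifP.
  by move: (xB i) (yC i); rewrite /merge /B /C /=; case: ifP.
have mB i : measurable (B i) by rewrite /B; case: ifP.
have mC i : measurable (C i) by rewrite /C; case: ifP.
transitivity (nu (rectangle B) * nu (rectangle C))%E.
  by apply: product_measure1E; apply: measurable_rectangle.
rewrite !nuE// -big_split/=; apply: eq_bigr => i _; rewrite /B /C.
by case: ifP => _; rewrite probability_setT ?mul1e ?mule1.
Qed.

Lemma law_reindex sigma : bijective sigma ->
  (forall i, mu (sigma i) = mu i) ->
  has_product_law nu (reindex_config sigma).
Proof.
move=> [tau sK tK] musig; split; first exact: measurable_reindex.
move=> A mA.
have -> : reindex_config sigma @^-1` rectangle A = rectangle (A \o tau).
  apply/seteqP; split => [z zA i|z zA i] /=.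
    by have := zA (tau i); rewrite /reindex_config /= tK.
  by have := zA (sigma i); rewrite /reindex_config /= sK.
rewrite nuE; last by move=> i; apply: mA.
rewrite (reindex sigma); last by exists tau => i _.
by apply: eq_bigr => i _; rewrite /= sK musig.
Qed.

Lemma marginal_law i (B : set R) : measurable B ->
  nu [set z | B (z i)] = mu i B.
Proof.
move=> mB; pose A j := if j == i then B else [set: R].
have -> : [set z : config | B (z i)] = rectangle A.
  apply/seteqP; split => [z /= zB j|z /(_ i)]; last by rewrite /A eqxx.
  by rewrite /A; case: eqP => // ->.
rewrite nuE; last by move=> j; rewrite /A; case: eqP.
rewrite (bigD1 i)//= big1 ?mule1 => [|j ji]; rewrite /A ?eqxx//.
by rewrite (negbTE ji) probability_setT.
Qed.

Lemma ge0_integral_marginal i (g : R -> \bar R) :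
  measurable_fun [set: R] g -> (forall x, 0 <= g x)%E ->
  (\int[nu]_z g (z i) = \int[mu i]_x g x)%E.
Proof.
move=> mg g0.
pose c : {mfun config >-> measurableTypeR R} := HB.pack (fun z : config => z i)
  (isMeasurableFun.Build _ _ config (measurableTypeR R) (fun z : config => z i) (measurable_coord i)).
rewrite (eq_measure_integral (distribution nu c)); last first.
  by move=> B mB _; rewrite /= -(marginal_law i mB).
by rewrite ge0_integral_distribution.
Qed.

End Laws.

Section Resampling.
Context {R : realType} {V : finType}.
Local Notation I := (V + V + V)%type.
Local Notation config := (config R I).

Definition old (v : V) : I := inl (inl v).
Definition fresh (v : V) : I := inl (inr v).
Definition clock (v : V) : I := inr v.

Definition exchange (A : {set V}) (i : I) : I :=
  match i with
  | inl (inl v) => if v \in A then fresh v else old v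
  | inl (inr v) => if v \in A then old v else fresh v
  | inr v => clock v
  end.

Definition resample A : config -> config := reindex_config (exchange A).

Lemma exchangeK A : involutive (exchange A).
Proof. by case=> [[]|] v //=; case: ifP => vA /=; rewrite vA. Qed.

Lemma resampleK A : involutive (resample A).
Proof. by move=> z; apply/funext => i; rewrite /resample /reindex_config /= exchangeK. Qed.

Lemma resample0 z : resample finset.set0 z = z.
Proof.
by apply/funext => -[[]|] v; rewrite /resample /reindex_config /= ?inE.
Qed.

Lemma resampleU1 v (A : {set V}) z : v \notin A ->
  resample (v |: A)%SET z = resample A (resample [set v]%SET z).
Proof.
move=> vA; apply/funext => -[[]|] u; rewrite /resample /reindex_config //= !inE;
  by case: eqP => [->|/eqP uv]; rewrite ?(negbTE vA) /= ?inE ?eqxx//;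
     case: ifP => _ /=; rewrite inE (negbTE uv).
Qed.

Lemma resampleC v (A : {set V}) z : v \notin A ->
  resample A (resample [set v]%SET z) = resample [set v]%SET (resample A z).
Proof.
move=> vA; apply/funext => -[[]|] u; rewrite /resample /reindex_config //= !inE;
  by case: eqP => [->|/eqP uv]; rewrite ?(negbTE vA) /= ?inE ?eqxx ?(negbTE vA)//;
     case: ifP => _ /=; rewrite inE (negbTE uv).
Qed.

Lemma measurable_resample A : measurable_fun [set: config] (resample A).
Proof. exact: measurable_reindex. Qed.

Definition total_size (z : config) : R :=
  1 + \sum_v (`|z (old v)| + `|z (fresh v)|).

Lemma total_size_ge1 z : 1 <= total_size z.
Proof. by rewrite lerDl sumr_ge0// => v _; rewrite addr_ge0. Qed.

Lemma total_size_gt0 z : 0 < total_size z.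
Proof. exact: lt_le_trans ltr01 (total_size_ge1 z). Qed.

Lemma total_size_resample A z : total_size (resample A z) = total_size z.
Proof.
congr (_ + _); apply: eq_bigr => v _; rewrite /resample /reindex_config /=.
by case: ifP => _ //; rewrite addrC.
Qed.

Lemma total_size_merge K x y :
  total_size (merge K x y) <= total_size x * total_size y.
Proof.
pose a (z : config) := \sum_v (`|z (old v)| + `|z (fresh v)|).
have a0 z : 0 <= a z by rewrite sumr_ge0// => v _; rewrite addr_ge0.
have : a (merge K x y) <= a x + a y.
  rewrite /a -big_split/=; apply: ler_sum => v _; rewrite /merge.
  have := (normr_ge0 (x (old v)), normr_ge0 (y (old v)), normr_ge0 (x (fresh v)),
    normr_ge0 (y (fresh v))) => -[[[? ?] ?] ?].
  by case: ifP => _; case: ifP => _; lra.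
rewrite /total_size -!/(a _) => axy.
have := mulr_ge0 (a0 x) (a0 y).
rewrite mulrDl mul1r mulrDr mulr1; lra.
Qed.

Lemma measurable_total_size : measurable_fun [set: config] total_size.
Proof.
apply: measurable_funD => //; apply: measurable_sum => v.
by apply: measurable_funD; apply: measurableT_comp => //; apply: measurable_coord.
Qed.

Definition lin_growth (h : config -> R) := measurable_fun [set: config] h /\
  exists K, forall z, `|h z| <= K * total_size z.

Definition quad_growth (h : config -> R) := measurable_fun [set: config] h /\
  exists K, forall z, `|h z| <= K * total_size z ^+ 2.

Lemma growth_ge0 n (h : config -> R) K :
  (forall z, `|h z| <= K * total_size z ^+ n) -> 0 <= K.
Proof.
move=> /(_ (fun=> 0)) /(le_trans (normr_ge0 _)).
by rewrite pmulr_lge0// exprn_gt0// total_size_gt0.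
Qed.

Lemma lin_growthM h g : lin_growth h -> lin_growth g ->
  quad_growth (fun z => h z * g z).
Proof.
move=> [mh [K hK]] [mg [L gL]]; split; first exact: measurable_funM.
exists (K * L) => z; rewrite normrM.
apply: (le_trans (ler_pM _ _ (hK z) (gL z))) => //.
by rewrite mulrACA -expr2.
Qed.

Lemma lin_growthB h g : lin_growth h -> lin_growth g ->
  lin_growth (fun z => h z - g z).
Proof.
move=> [mh [K hK]] [mg [L gL]]; split; first exact: measurable_funB.
exists (K + L) => z; rewrite mulrDl.
by apply: (le_trans (ler_normB _ _)); apply: lerD.
Qed.

Lemma quad_growthD h g : quad_growth h -> quad_growth g ->
  quad_growth (fun z => h z + g z).
Proof.
move=> [mh [K hK]] [mg [L gL]]; split; first exact: measurable_funD.
exists (K + L) => z; rewrite mulrDl.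
by apply: (le_trans (ler_normD _ _)); apply: lerD.
Qed.

Lemma quad_growthZ a h : quad_growth h -> quad_growth (fun z => a * h z).
Proof.
move=> [mh [K hK]]; split; first exact: measurable_funM.
by exists (`|a| * K) => z; rewrite normrM -mulrA ler_wpM2l.
Qed.

Lemma quad_growthB h g : quad_growth h -> quad_growth g ->
  quad_growth (fun z => h z - g z).
Proof.
move=> qh qg; have := quad_growthD qh (quad_growthZ (-1) qg).
by congr quad_growth; apply/funext => z; rewrite mulN1r.
Qed.

Lemma quad_growth_sum (J : Type) (r : seq J) (P : pred J) (h : J -> config -> R) :
  (forall j, P j -> quad_growth (h j)) ->
  quad_growth (fun z => \sum_(j <- r | P j) h j z).
Proof.
move=> qh; elim: r => [|j r ih].
  under eq_fun do rewrite big_nil.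
  by split => //; exists 0 => z; rewrite normr0 mul0r.
have [Pj|/negbTE Pj] := boolP (P j); last by under eq_fun do rewrite big_cons Pj.
under eq_fun do rewrite big_cons Pj.
by apply: quad_growthD => //; apply: qh.
Qed.

Lemma lin_growth_cst a : lin_growth (fun=> a).
Proof.
split => //; exists `|a| => z; rewrite ler_peMr//; exact: total_size_ge1.
Qed.

Lemma lin_quad_growth h : lin_growth h -> quad_growth h.
Proof.
move=> lh; have := lin_growthM lh (lin_growth_cst 1); congr quad_growth.
by apply/funext => z; rewrite mulr1.
Qed.

Lemma quad_growth_bounded h (g : config -> R) a : quad_growth h ->
  measurable_fun [set: config] g -> (forall z, `|g z| <= a) ->
  quad_growth (fun z => g z * h z).
Proof.
move=> [mh [K hK]] mg ga; split; first exact: measurable_funM.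
by exists (a * K) => z; rewrite normrM -mulrA; apply: ler_pM.
Qed.

Lemma bounded_quad_growth (g : config -> R) a :
  measurable_fun [set: config] g -> (forall z, `|g z| <= a) -> quad_growth g.
Proof.
move=> mg ga; have := quad_growth_bounded (lin_quad_growth (lin_growth_cst 1)) mg ga.
by congr quad_growth; apply/funext => z; rewrite mulr1.
Qed.

Lemma lin_growth_resample A h : lin_growth h -> lin_growth (h \o resample A).
Proof.
move=> [mh [K hK]]; split; first exact: (measurableT_comp mh (measurable_resample A)).
by exists K => z /=; rewrite -(total_size_resample A).
Qed.

Lemma quad_growth_resample A h : quad_growth h -> quad_growth (h \o resample A).
Proof.
move=> [mh [K hK]]; split; first exact: (measurableT_comp mh (measurable_resample A)).
by exists K => z /=; rewrite -(total_size_resample A).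
Qed.

Lemma quad_growth_mergel K x h : quad_growth h -> quad_growth (h \o merge K x).
Proof.
move=> [mh [L hL]]; split; first exact: (measurableT_comp mh (measurable_mergel K x)).
have L0 := growth_ge0 hL.
exists (L * total_size x ^+ 2) => z /=.
rewrite (le_trans (hL _))// -mulrA ler_wpM2l// -exprMn.
apply: lerXn2r; last exact: total_size_merge.
- by rewrite nnegrE ltW// total_size_gt0.
- by rewrite nnegrE mulr_ge0// ltW// total_size_gt0.
Qed.

Lemma lin_growth_mergel K x h : lin_growth h -> lin_growth (h \o merge K x).
Proof.
move=> [mh [L hL]]; split; first exact: (measurableT_comp mh (measurable_mergel K x)).
have L0 : 0 <= L by apply: (@growth_ge0 1 h) => z; rewrite expr1.
exists (L * total_size x) => z /=.
by rewrite (le_trans (hL _))// -mulrA ler_wpM2l// total_size_merge.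
Qed.

End Resampling.

Section Covariances.
Context {R : realType} {V : finType}.
Local Notation I := (V + V + V)%type.
Local Notation config := (config R I).
Variables (mu : I -> probability (measurableTypeR R) R)
  (nu : probability config R).
Hypothesis nuE : product_law nu mu.
Hypothesis mu_fresh : forall v, mu (fresh v) = mu (old v).
Hypothesis total_size_L2 : (\int[nu]_z (total_size z ^+ 2)%:E < +oo)%E.

Local Notation mean h := (\int[nu]_z h z).

Lemma quad_integrable h : quad_growth h -> nu.-integrable [set: config] (EFin \o h).
Proof.
move=> [mh [K hK]].
have K0 := growth_ge0 hK.
apply: (@le_integrable _ _ _ nu _ measurableT _
    (fun z => K%:E * (total_size z ^+ 2)%:E)%E).
- exact/measurable_EFinP.
- move=> z _; rewrite /= lee_fin (le_trans (hK z))// ler_norm//.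
apply: integrableZl => //; apply/integrableP; split.
  by apply/measurable_EFinP; apply: measurable_funX; apply: measurable_total_size.
under eq_integral do rewrite /= ger0_norm ?sqr_ge0//.
by [].
Qed.

Lemma mean_fin h : quad_growth h -> (\int[nu]_z (h z)%:E)%E = (mean h)%:E.
Proof.
move=> qh; rewrite /Rintegral fineK//.
by apply: integrable_fin_num => //; apply: quad_integrable.
Qed.

Lemma meanD h g : quad_growth h -> quad_growth g ->
  mean (fun z => h z + g z) = mean h + mean g.
Proof. by move=> qh qg; rewrite RintegralD//; apply: quad_integrable. Qed.

Lemma meanB h g : quad_growth h -> quad_growth g ->
  mean (fun z => h z - g z) = mean h - mean g.
Proof. by move=> qh qg; rewrite RintegralB//; apply: quad_integrable. Qed.

Lemma meanZ a h : quad_growth h -> mean (fun z => a * h z) = a * mean h.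
Proof. by move=> qh; rewrite RintegralZl//; apply: quad_integrable. Qed.

Lemma mean_cst a : mean (fun=> a) = a.
Proof.
rewrite Rintegral_cst// -[RHS]mulr1; congr (_ * _).
by rewrite [X in fine X](probability_setT nu).
Qed.

Lemma le_mean h g : quad_growth h -> quad_growth g ->
  (forall z, h z <= g z) -> mean h <= mean g.
Proof. by move=> qh qg hg; apply: le_Rintegral => //; apply: quad_integrable. Qed.

Lemma mean_sum (J : Type) (r : seq J) (P : pred J) (h : J -> config -> R) :
  (forall j, P j -> quad_growth (h j)) ->
  mean (fun z => \sum_(j <- r | P j) h j z) = \sum_(j <- r | P j) mean (h j).
Proof.
move=> qh; elim: r => [|j r ih].
  by under eq_Rintegral do rewrite big_nil; rewrite big_nil mean_cst.
rewrite big_cons; have [Pj|/negbTE Pj] := boolP (P j).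
  under eq_Rintegral do rewrite big_cons Pj.
  by rewrite meanD ?ih//; [apply: qh|apply: quad_growth_sum].
by under eq_Rintegral do rewrite big_cons Pj.
Qed.

Lemma mean_resample A h : quad_growth h -> mean (h \o resample A) = mean h.
Proof.
move=> qh; rewrite /Rintegral; congr fine.
have law : has_product_law mu nu (resample A).
  apply: law_reindex => //; first by exists (exchange A); apply: exchangeK.
  by case=> [[]|] v //=; case: ifP => _ //; rewrite mu_fresh.
by rewrite [RHS](integral_law nuE law)//; apply: quad_integrable.
Qed.

Lemma mean_merge K h : quad_growth h ->
  (mean h)%:E = (\int[nu]_x \int[nu]_y (h (merge K x y))%:E)%E.
Proof.
move=> qh; rewrite -mean_fin//.
rewrite (integral_law nuE (law_merge nuE K)) /=; last exact: quad_integrable.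
have int := integrable_law nuE (law_merge nuE K) (quad_integrable qh).
exact: (esym (integral12_prod_meas1 int)).
Qed.

Lemma mean_indep K h g : quad_growth h -> quad_growth g ->
  quad_growth (fun z => h z * g z) ->
  (forall x y, h (merge K x y) = h x) -> (forall x y, g (merge K x y) = g y) ->
  mean (fun z => h z * g z) = mean h * mean g.
Proof.
move=> qh qg qhg hK gK; apply: EFin_inj; rewrite (mean_merge K)//.
under eq_integral => x _.
  under eq_integral => y _ do rewrite hK gK EFinM.
  rewrite integralZl//; last exact: quad_integrable.
  rewrite mean_fin// muleC.
  over.
by rewrite integralZl//; [rewrite mean_fin// -EFinM mulrC|apply: quad_integrable].
Qed.

Definition no_fresh (A : {set V}) (h : config -> R) := forall z z',
  (forall i, (forall v, v \in A -> i != fresh v) -> z i = z' i) -> h z = h z'.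

Definition resampled_moment (h : config -> R) A : R :=
  mean (fun z => h z * h (resample A z)).

(* Given the weights off [A], [h z] and [h (resample A z)] are independent and
   have the same law. *)
Lemma resampled_moment_ge0 h A : lin_growth h -> no_fresh A h ->
  0 <= resampled_moment h A.
Proof.
move=> lh hA; pose Fr : {set I} := [set i in [seq fresh v | v in A]]%SET.
pose K := ([set i in [seq old v | v in A]] :|: Fr)%SET.
have FrP v : (fresh v \in Fr) = (v \in A).
  by rewrite inE; apply/mapP/idP => [[u + [->]]|vA]; rewrite ?mem_enum//; exists v; rewrite ?mem_enum.
have FrF i : i \in Fr -> exists2 v, v \in A & i = fresh v.
  by rewrite inE => /mapP[v]; rewrite mem_enum; exists v.
have oldFr v : old v \in Fr = false.
  by apply/negP => /FrF[].
have KoldP v : (old v \in K) = (v \in A).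
  rewrite inE oldFr orbF inE; apply/mapP/idP => [[u + [->]]|vA]; rewrite ?mem_enum//.
  by exists v; rewrite ?mem_enum.
have KfreshP v : (fresh v \in K) = (v \in A).
  rewrite inE FrP orb_idl// inE => /mapP[u _]; done.
have KclockP v : (clock v \in K) = false.
  by apply/negP; rewrite !inE => /orP[] /mapP[].
have qhh : quad_growth (fun z => h z * h (resample A z)).
  by apply: lin_growthM => //; apply: lin_growth_resample.
rewrite -lee_fin [leRHS](mean_merge K)//.
apply: integral_ge0 => x _.
pose f w := h (merge K x w); pose g w := h (resample A (merge K x w)).
have lf : lin_growth f := lin_growth_mergel K x lh.
have lg : lin_growth g := lin_growth_mergel K x (lin_growth_resample A lh).
have fg w : g w = f (resample A w).
  congr h; apply/funext => -[[]|] v; rewrite /resample /merge /reindex_config /= -?/(old v) -?/(fresh v) -?/(clock v).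
  - by case vA: (v \in A); rewrite ?KoldP ?KfreshP vA.
  - by case vA: (v \in A); rewrite ?KoldP ?KfreshP vA.
  - by rewrite KclockP.
rewrite (_ : \int[nu]_y _ = (mean f * mean g)%:E)%E; last first.
  rewrite -(@mean_indep Fr); [|exact: lin_quad_growth|exact: lin_quad_growth|exact: lin_growthM|..].
  - by rewrite mean_fin//; apply: lin_growthM.
  - move=> w w'; apply: hA => i iA; rewrite /merge; case: ifP => // _; case: ifP => // /FrF[v vA iv].
    by have := iA v vA; rewrite iv eqxx.
  - move=> w w'; apply: hA => -[[]|] v iA; rewrite /resample /merge /reindex_config /= -?/(old v) -?/(fresh v) -?/(clock v).
    + by case vA: (v \in A); rewrite ?KoldP ?KfreshP ?FrP vA.
    + case vA: (v \in A); rewrite ?KfreshP ?vA//.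
      by have := iA v vA; rewrite eqxx.
    + by rewrite KclockP.
rewrite (_ : mean g = mean f) -?expr2 ?lee_fin ?sqr_ge0//.
rewrite -[RHS](mean_resample A); last exact: lin_quad_growth.
by apply: eq_Rintegral => w _; rewrite fg.
Qed.

Definition increment v (h : config -> R) z : R := h z - h (resample [set v]%SET z).

Lemma lin_growth_increment v h : lin_growth h -> lin_growth (increment v h).
Proof. by move=> lh; apply: lin_growthB => //; apply: lin_growth_resample. Qed.

Lemma no_fresh_increment v (A : {set V}) h : v \notin A -> no_fresh A h ->
  no_fresh A (increment v h).
Proof.
move=> vA hA z z' zz'; congr (_ - _); apply: hA => // i iA.
apply: zz' => u uA; case: i iA => [[]|] w iA //=; rewrite inE.
- by have [->|//] := eqVneq w v; apply: contraNneq vA => -[->].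
- by have [//|_] := eqVneq w v; apply: iA.
Qed.

Lemma resampled_momentU1 h v (A : {set V}) : lin_growth h -> v \notin A ->
  resampled_moment h A - resampled_moment h (v |: A)%SET =
  2^-1 * resampled_moment (increment v h) A.
Proof.
move=> lh vA; rewrite /resampled_moment /increment.
pose k B C z := h (resample B z) * h (resample C z).
have qk B C : quad_growth (k B C).
  by apply: lin_growthM; apply: lin_growth_resample.
have -> : mean (fun z => (h z - h (resample [set v]%SET z)) *
      (h (resample A z) - h (resample [set v]%SET (resample A z)))) =
    mean (fun z => k finset.set0 A z - k finset.set0 (v |: A)%SET z -
      (k [set v]%SET A z - k [set v]%SET (v |: A)%SET z)).
  apply: eq_Rintegral => z _; rewrite /k resample0 resampleU1// resampleC//; ring.
have qB B C B' C' : quad_growth (fun z => k B C z - k B' C' z).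
  exact: quad_growthB.
rewrite !meanB//; [|exact: qB|exact: qB].
have -> : mean (k [set v]%SET A) = mean (k finset.set0 (v |: A)%SET).
  rewrite -[RHS](mean_resample [set v]%SET)//; apply: eq_Rintegral => z _ /=.
  by rewrite /k resample0 resampleU1// resampleK.
have -> : mean (k [set v]%SET (v |: A)%SET) = mean (k finset.set0 A).
  rewrite -[RHS](mean_resample [set v]%SET)//; apply: eq_Rintegral => z _ /=.
  by rewrite /k resample0 resampleU1.
have kE B : mean (fun z => h z * h (resample B z)) = mean (k finset.set0 B).
  by apply: eq_Rintegral => z _; rewrite /k resample0.
by rewrite !kE; field.
Qed.

Lemma resampled_moment_anti h (A B : {set V}) : lin_growth h -> no_fresh B h ->
  A \subset B -> resampled_moment h B <= resampled_moment h A.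
Proof.
move=> lh; move: {2}#|B :\: A|%SET (leqnn #|B :\: A|%SET) => m.
elim: m B => [|m ih] B.
  rewrite leqn0 cards_eq0 finset.setD_eq0 => BA _ AB.
  by rewrite (_ : B = A)//; apply/eqP; rewrite finset.eqEsubset BA AB.
move=> Bm hB AB; have [BA|] := boolP (B \subset A).
  by rewrite (_ : B = A)//; apply/eqP; rewrite finset.eqEsubset BA AB.
move=> /subsetPn[v vB vA]; have eB := finset.setD1K vB.
have hBv : no_fresh (B :\ v)%SET h.
  move=> z z' zz'; apply: hB => i iB; apply: zz' => u uB.
  by apply: iB; move: uB; rewrite inE => /andP[].
have vBv : v \notin (B :\ v)%SET by rewrite !inE eqxx.
apply: (@le_trans _ _ (resampled_moment h (B :\ v)%SET)).
  rewrite -subr_ge0 -{2}eB resampled_momentU1// mulr_ge0//.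
  apply: resampled_moment_ge0; first exact: lin_growth_increment.
  exact: no_fresh_increment.
apply: ih => //; last by rewrite subsetD1 AB.
rewrite -ltnS (leq_trans _ Bm)//; apply: proper_card; apply/properP; split.
  by apply: finset.setSD; apply: subsetDl.
by exists v; rewrite !inE ?vA ?vB// eqxx.
Qed.

Section Sandwich.
Variable f : config -> R.
Hypotheses (lf : lin_growth f) (f_old : no_fresh [set: V]%SET f).

Let no_freshS A (h : config -> R) : no_fresh [set: V]%SET h -> no_fresh A h.
Proof. by move=> hT z z' zz'; apply: hT => i iT; apply: zz' => v _; apply: iT. Qed.

Let f_incr v (A : {set V}) : v \notin A -> no_fresh A (increment v f).
Proof. by move=> vA; apply: no_fresh_increment => //; apply: no_freshS. Qed.

Lemma resampled_moment_drop_le (A : {set V}) :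
  resampled_moment f finset.set0 - resampled_moment f A <=
  \sum_(v in A) 2^-1 * resampled_moment (increment v f) finset.set0.
Proof.
move: {2}#|A| (erefl #|A|) => m; elim: m A => [|m ih] A.
  by move=> /eqP; rewrite cards_eq0 => /eqP ->; rewrite subrr big_set0.
move=> Am; have /card_gt0P[v vA] : (0 < #|A|)%N by rewrite Am.
have vAv : v \notin (A :\ v)%SET by rewrite !inE eqxx.
have Avm : #|A :\ v|%SET = m by move: Am; rewrite (cardsD1 v A) vA => -[].
have := ih _ Avm; rewrite (big_setD1 v vA)/=.
have := resampled_momentU1 lf vAv; rewrite finset.setD1K//.
have := resampled_moment_anti (lin_growth_increment v lf) (f_incr vAv)
  (finset.sub0set _).
lra.
Qed.

Lemma resampled_moment_drop_ge (A : {set V}) :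
  \sum_(v in A) 2^-1 * resampled_moment (increment v f) (A :\ v)%SET <=
  resampled_moment f finset.set0 - resampled_moment f A.
Proof.
move: {2}#|A| (erefl #|A|) => m; elim: m A => [|m ih] A.
  by move=> /eqP; rewrite cards_eq0 => /eqP ->; rewrite subrr big_set0.
move=> Am; have /card_gt0P[v vA] : (0 < #|A|)%N by rewrite Am.
have vAv : v \notin (A :\ v)%SET by rewrite !inE eqxx.
have Avm : #|A :\ v|%SET = m by move: Am; rewrite (cardsD1 v A) vA => -[].
have := ih _ Avm; rewrite (big_setD1 v vA)/=.
have := resampled_momentU1 lf vAv; rewrite finset.setD1K//.
have : \sum_(u in (A :\ v)%SET) 2^-1 * resampled_moment (increment u f) (A :\ u)%SET <=
    \sum_(u in (A :\ v)%SET) 2^-1 * resampled_moment (increment u f) (A :\ v :\ u)%SET.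
  apply: ler_sum => u _; rewrite ler_wpM2l//; apply: resampled_moment_anti.
  - exact: lin_growth_increment.
  - by apply: f_incr; rewrite !inE eqxx.
  - by apply: finset.setSD; apply: subsetDl.
lra.
Qed.

Lemma resampled_moment_ge_mean A : mean f ^+ 2 <= resampled_moment f A.
Proof.
pose m := mean f; have lm := lin_growth_cst m : lin_growth (fun=> m).
have : 0 <= resampled_moment (fun z => f z - m) A.
  apply: resampled_moment_ge0; first exact: lin_growthB.
  by move=> z z' zz'; congr (_ - _); apply: no_freshS zz'.
have qf := lin_quad_growth lf; have qfA := quad_growth_resample A qf.
have qff : quad_growth (fun z => f z * f (resample A z)).
  by apply: lin_growthM => //; apply: lin_growth_resample.
have -> : resampled_moment (fun z => f z - m) A =
    mean (fun z => f z * f (resample A z) - (m * f z + (m * (f \o resample A) z - m ^+ 2))).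
  by apply: eq_Rintegral => z _ /=; ring.
have qc : quad_growth (fun _ : config => m ^+ 2).
  exact/lin_quad_growth/lin_growth_cst.
have q1 := quad_growthZ m qf; have q2 := quad_growthZ m qfA.
rewrite meanB//; last by apply: quad_growthD => //; apply: quad_growthB.
rewrite meanD//; last exact: quad_growthB.
rewrite meanB// mean_cst !meanZ// mean_resample// -/m /resampled_moment; lra.
Qed.

End Sandwich.

End Covariances.

Section Paths.
Context {R : realType} {d n : nat}.
Local Notation site := (site d n).
Local Notation paths := (@directed_paths d n).
Implicit Types (v : site) (g S : {set site}) (w : site -> R).

Lemma passage_time_ge0 w : 0 <= passage_time w.
Proof. exact: bigmax_ge_id. Qed.

Lemma path_weight_le w g : g \in paths -> path_weight w g <= passage_time w.
Proof. by move=> gP; rewrite /passage_time (le_bigmax_cond _ (path_weight w)). Qed.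

Lemma passage_time_le w (a : R) : 0 <= a ->
  (forall g, g \in paths -> path_weight w g <= a) -> passage_time w <= a.
Proof. by move=> a0 wa; apply: bigmax_le. Qed.

Lemma passage_time_attained w : passage_time w = 0 \/
  exists2 g, g \in paths & passage_time w = path_weight w g.
Proof.
rewrite /passage_time; elim/big_ind: _ => [|x y|g gP]; first by left.
  by move=> hx hy; rewrite /Num.max; case: ifP.
by right; exists g.
Qed.

Lemma passage_time_le_sum w : passage_time w <= \sum_v `|w v|.
Proof.
apply: passage_time_le => [|g _]; first exact: sumr_ge0.
rewrite /path_weight big_mkcond; apply: ler_sum => v _.
by case: ifP => // _; apply: ler_norm.
Qed.

Section Decomposition.
Variables (v : site) (g0 : {set site}).
Hypotheses (g0P : g0 \in paths) (vg0 : v \in g0).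

Definition detour_time w : R :=
  \big[Num.max/0]_(g in paths | v \notin g) path_weight w g.

Definition through_time w : R :=
  \big[Num.max/path_weight w (g0 :\ v)%SET]_(g in paths | v \in g)
    path_weight w (g :\ v)%SET.

Lemma path_weightD1 w g : v \in g ->
  path_weight w g = path_weight w (g :\ v)%SET + w v.
Proof. by move=> vg; rewrite /path_weight (big_setD1 v)//= addrC. Qed.

Lemma through_time_attained w : exists g, [/\ g \in paths, v \in g &
  through_time w + w v = path_weight w g].
Proof.
have [g [gP vg ->]] : exists g, [/\ g \in paths, v \in g &
    through_time w = path_weight w (g :\ v)%SET].
  rewrite /through_time; elim/big_ind: _ => [|x y|g /andP[gP vg]].
  - by exists g0.
  - by move=> hx hy; rewrite /Num.max; case: ifP.
  - by exists g.
by exists g; rewrite -path_weightD1.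
Qed.

Lemma path_weight_le_through w g : g \in paths -> v \in g ->
  path_weight w g <= through_time w + w v.
Proof.
move=> gP vg; rewrite path_weightD1// lerD2r /through_time.
by rewrite (le_bigmax_cond _ (fun g => path_weight w (g :\ v)%SET))// gP vg.
Qed.

Lemma passage_time_decomp w :
  passage_time w = Num.max (detour_time w) (through_time w + w v).
Proof.
apply/eqP; rewrite eq_le; apply/andP; split.
  apply: passage_time_le => [|g gP].
    by rewrite le_max bigmax_ge_id.
  rewrite le_max; have [vg|vg] := boolP (v \in g).
    by rewrite path_weight_le_through// orbT.
  by rewrite /detour_time (le_bigmax_cond _ (path_weight w))// gP vg.
rewrite ge_max; apply/andP; split.
  apply: bigmax_le => [|g /andP[gP _]]; first exact: passage_time_ge0.
  exact: path_weight_le.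
by have [g [gP _ ->]] := through_time_attained w; apply: path_weight_le.
Qed.

Lemma mem_geodesic_sites w :
  (v \in geodesic_sites w) = (detour_time w <= through_time w + w v).
Proof.
rewrite inE; apply/existsP/idP => [[g /andP[/andP[gP /eqP gT] vg]]|le_dt].
  rewrite (le_trans _ (path_weight_le_through w gP vg))// gT.
  by rewrite passage_time_decomp le_max lexx.
have [g [gP vg eg]] := through_time_attained w.
exists g; rewrite /geodesic gP vg -eg passage_time_decomp andbT /=.
by apply/eqP/esym/max_idPr.
Qed.

Lemma detour_time_ext w w' : (forall u, u != v -> w u = w' u) ->
  detour_time w = detour_time w'.
Proof.
move=> ww'; apply: eq_bigr => g /andP[_ vg]; apply: eq_bigr => u ug.
by apply: ww'; apply: contraNneq vg => <-.
Qed.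

Lemma through_time_ext w w' : (forall u, u != v -> w u = w' u) ->
  through_time w = through_time w'.
Proof.
move=> ww'; have e g : path_weight w (g :\ v)%SET = path_weight w' (g :\ v)%SET.
  by apply: eq_bigr => u; rewrite !inE => /andP[uv _]; apply: ww'.
by rewrite /through_time e; apply: eq_bigr.
Qed.

End Decomposition.

Lemma notin_geodesic_sites v w : (forall g, g \in paths -> v \notin g) ->
  v \notin geodesic_sites w.
Proof.
move=> vP; rewrite inE; apply/existsP => -[g /andP[/andP[gP _]]].
by rewrite (negbTE (vP g gP)).
Qed.

Definition update w w' v : site -> R := fun u => if u == v then w' u else w u.

(* Only the sites of one fixed maximal path contribute. *)
Lemma sum_passage_time_drop w w' :
  \sum_v (Num.max 0 (passage_time w - passage_time (update w w' v))) ^+ 2 <=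
  2 * passage_time (fun v => w v ^+ 2) + 2 * passage_time (fun v => w' v ^+ 2).
Proof.
have [T0|[g gP Tg]] := passage_time_attained w.
  rewrite big1 => [|v _].
    by rewrite addr_ge0// mulr_ge0// passage_time_ge0.
  by rewrite T0 sub0r max_l ?expr0n// oppr_le0 passage_time_ge0.
apply: (@le_trans _ _ (\sum_(v in g) (w v - w' v) ^+ 2)).
  rewrite [leRHS]big_mkcond; apply: ler_sum => v _.
  have := path_weight_le (update w w' v) gP; case: ifP => vg.
    rewrite (path_weightD1 _ vg) => le_v.
    have : passage_time w - passage_time (update w w' v) <= w v - w' v.
      rewrite Tg (path_weightD1 _ vg).
      have e : path_weight w (g :\ v)%SET = path_weight (update w w' v) (g :\ v)%SET.
        by apply: eq_bigr => u; rewrite !inE /update => /andP[/negbTE -> _].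
      move: le_v; rewrite -e [update w w' v v]/update eqxx; lra.
    set D := _ - passage_time _; set D' := w v - w' v => DD'.
    rewrite /Num.max; case: ifP => [D0|_]; last by rewrite expr0n sqr_ge0.
    by rewrite lerXn2r// nnegrE; [apply: ltW|apply: le_trans DD'; apply: ltW].
  have -> : path_weight (update w w' v) g = passage_time w.
    rewrite Tg; apply: eq_bigr => u ug; rewrite /update; case: eqP => // uv.
    by rewrite -uv ug in vg.
  by move=> D0; rewrite max_l ?subr_le0// expr0n.
apply: (@le_trans _ _ (2 * path_weight (fun v => w v ^+ 2) g +
    2 * path_weight (fun v => w' v ^+ 2) g)).
  rewrite /path_weight !mulr_sumr -big_split/=; apply: ler_sum => v _.
  have := sqr_ge0 (w v + w' v); rewrite sqrrD sqrrB !mulr2n; lra.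
by rewrite lerD// ler_wpM2l// path_weight_le.
Qed.

End Paths.

Section Chains.
Context {d n : nat}.
Local Notation site := (site d n).
Implicit Types (v : site) (S : {set site}).

Definition site_le : rel site := fun v v' => [forall i, (v i <= v' i)%N].

Definition chain S := [forall u in S, forall v in S, site_le u v || site_le v u].

Lemma site_le_trans : transitive site_le.
Proof.
move=> v u w /forallP uv /forallP vw; apply/forallP => i.
exact: leq_trans (uv i) (vw i).
Qed.

Lemma chain_directed_path g S : g \in directed_paths -> S \subset g -> chain S.
Proof.
rewrite inE => /asboolP[s [ps _ gs]] /fintype.subsetP Sg.
have : pairwise site_le (@origin d n :: s).
  rewrite -sorted_pairwise; last exact: site_le_trans.
  rewrite /=; apply: sub_path ps => u v /existsP[i /forallP uv].
  by apply/forallP => j; rewrite (eqP (uv j)) leq_addr.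
move=> /(pairwiseP (@origin d n)) le_s.
apply/'forall_implyP => u /Sg; rewrite gs => us.
apply/'forall_implyP => v /Sg; rewrite gs => vs.
rewrite -(nth_index (@origin d n) us) -(nth_index (@origin d n) vs).
have [ij|ij|->] := ltngtP (index u (@origin d n :: s)) (index v (@origin d n :: s)).
- by rewrite le_s// inE index_mem.
- by rewrite orbC le_s// inE index_mem.
- by rewrite orbb; apply/forallP.
Qed.

Lemma chainP S : reflect {in S &, forall u v, site_le u v || site_le v u} (chain S).
Proof.
apply: (iffP forall_inP) => [h u v uS vS|h u uS].
  by move: (h u uS) => /forall_inP; apply.
by apply/forall_inP => v vS; apply: h.
Qed.

Lemma card_chain S : chain S -> (#|S| <= (d * n).+1)%N.
Proof.
move=> /chainP cS; pose h v := (\sum_i nat_of_ord (v i))%N.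
have hle v : (h v < (d * n).+1)%N.
  rewrite ltnS /h -[X in (_ <= X * _)%N]card_ord -sum_nat_const.
  by apply: leq_sum => i _; rewrite -ltnS.
have inj u v : site_le u v -> h u = h v -> u = v.
  move=> /forallP uv /eqP; rewrite (leqif_sum (fun i _ => leqif_eq (uv i))) /=.
  by move=> /forallP e; apply/ffunP => i; apply/val_inj/eqP/e.
rewrite -[leqRHS]card_ord -(@card_in_imset _ _ (fun v => Ordinal (hle v)) (mem S)).
  exact: max_card.
move=> u v uS vS /(congr1 val) /= huv.
by have [/inj|/inj ->] := orP (cS u v uS vS); first exact.
Qed.

Definition coordinates S : seq site := sort site_le (enum S).

Lemma coordinates_sorted S i : chain S ->
  sorted leq [seq val (v i) | v <- coordinates S].
Proof.
move=> /chainP cS; apply: (@homo_sorted _ _ (fun v : site => val (v i)) site_le).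
  by move=> u v /forallP; apply.
apply: (@sort_sorted_in _ (mem S)) => //.
by apply/allP => v; rewrite mem_enum.
Qed.

Lemma card_chains k :
  (#|[set S : {set site} | chain S & #|S| == k]%SET| <= 'C(k + n, k) ^ d)%N.
Proof.
pose tuple_of (S : {set site}) i : k.-tuple 'I_n.+1 :=
  insubd (nseq_tuple k ord0) [seq (v : site) i | v <- coordinates S].
pose code (S : {set site}) : {ffun 'I_d -> k.-tuple 'I_n.+1} := [ffun i => tuple_of S i].
have codeE (S : {set site}) i : #|S| = k ->
    code S i = [seq (v : site) i | v <- coordinates S] :> seq _.
  by move=> Sk; rewrite ffunE val_insubd size_map size_sort -cardE Sk eqxx.
rewrite -(@card_in_imset _ _ code); last first.
  move=> S S'; rewrite !inE => /andP[_ /eqP Sk] /andP[_ /eqP S'k] eq_code.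
  have e : coordinates S = coordinates S'.
    have sz (S0 : {set site}) : #|S0| = k -> size (coordinates S0) = k.
      by move=> <-; rewrite size_sort -cardE.
    apply: (@eq_from_nth _ (@origin d n)); first by rewrite !sz.
    move=> j; rewrite sz// => jk; apply/ffunP => i.
    have /= := congr1 (fun f : {ffun 'I_d -> k.-tuple 'I_n.+1} => nth ord0 (val (f i)) j) eq_code.
    by rewrite !codeE// !(nth_map (@origin d n)) ?sz.
  by apply/setP => v; rewrite -mem_enum -(mem_sort site_le) -/(coordinates S) e mem_sort mem_enum.
rewrite -card_sorted_tuples -[X in (_ <= _ ^ X)%N]card_ord -card_ffun_on.
apply: subset_leq_card; apply/fintype.subsetP => _ /imsetP[S + ->].
rewrite inE => /andP[cS /eqP Sk]; apply/ffun_onP => i; rewrite inE.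
by rewrite codeE// -map_comp; apply: coordinates_sorted.
Qed.

End Chains.

Section ChainSum.
Context {R : realType} {d n : nat}.
Local Notation site := (site d n).

Lemma exp_partial_sum_le (x : R) K : 0 <= x ->
  \sum_(k < K) x ^+ k / k`!%:R <= expR x.
Proof.
move=> x0; rewrite -(big_mkord xpredT (fun k => x ^+ k / k`!%:R)).
apply: (@nondecreasing_cvgn_le _ (series (exp_coeff x))).
  apply: nondecreasing_series => k _ _; exact: exp_coeff_ge0.
exact: is_cvg_series_exp_coeff.
Qed.

Lemma sum_exprn_le K (x : 'I_K -> R) m : (0 < m)%N -> (forall k, 0 <= x k) ->
  \sum_k x k ^+ m <= (\sum_k x k) ^+ m.
Proof.
case: m => // m _ x0; rewrite exprS mulr_suml; apply: ler_sum => k _.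
rewrite exprS ler_wpM2l// lerXn2r ?nnegrE ?sumr_ge0//.
by rewrite (bigD1 k)//= lerDl sumr_ge0.
Qed.

Lemma binomial_le_expn a k : ('C(a, k) * k`! <= a ^ k)%N.
Proof.
rewrite bin_ffact; elim: k => [|k ih]; first by rewrite ffactn0 expn0.
by rewrite ffactnSr expnSr leq_mul// leq_subr.
Qed.

(* There are at most ((d + 2) n) ^ (k d) / k! ^ d chains of cardinal k, and the sum of
   the d-th powers of the terms of the exponential series is at most the d-th
   power of its sum. *)
Lemma sum_chains_le (q : R) : (0 < d)%N -> (0 < n)%N -> 0 <= q ->
  \sum_(S : {set site} | chain S) (q ^+ d) ^+ #|S| <=
  expR (d.+2%:R * n%:R * q) ^+ d.
Proof.
move=> d0 n0 q0; pose K := (d * n).+2.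
have x0 : 0 <= d.+2%:R * n%:R * q by rewrite !mulr_ge0.
apply: (@le_trans _ _ ((\sum_(k < K) (d.+2%:R * n%:R * q) ^+ k / k`!%:R) ^+ d));
  last first.
  rewrite lerXn2r ?nnegrE ?expR_ge0 ?exp_partial_sum_le//.
  by apply: sumr_ge0 => k _; rewrite divr_ge0// exprn_ge0.
apply: le_trans (sum_exprn_le d0 _); last first.
  by move=> k; rewrite divr_ge0// exprn_ge0.
rewrite (partition_big (fun S : {set site} => inord #|S| : 'I_K) xpredT)//=.
apply: ler_sum => k _.
rewrite (eq_bigr (fun=> (q ^+ k) ^+ d)); last first.
  move=> S /andP[cS /eqP <-]; rewrite inordK ?ltnS ?card_chain//.
  by rewrite -!exprM mulnC.
rewrite sumr_const -[leLHS]mulr_natl.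
apply: (@le_trans _ _ (('C(k + n, k) ^ d)%:R * (q ^+ k) ^+ d)).
  rewrite ler_wpM2r ?exprn_ge0// ler_nat; apply: leq_trans (card_chains _).
  apply: subset_leq_card; apply/fintype.subsetP => S.
  rewrite !inE unfold_in /= => /andP[cS /eqP <-].
  by rewrite cS inordK ?ltnS ?card_chain// eqxx.
rewrite natrX -exprMn lerXn2r ?nnegrE ?mulr_ge0 ?divr_ge0 ?exprn_ge0//.
rewrite ler_pdivlMr ?ltr0n ?fact_gt0// exprMn -mulrA [_ ^+ k * _%:R]mulrC mulrA.
rewrite ler_wpM2r ?exprn_ge0// -!natrM -natrX ler_nat.
apply: leq_trans (binomial_le_expn _ _) _.
have [->//|k0] := posnP k.
rewrite leq_exp2r//; have := ltn_ord k; rewrite /K; lia.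
Qed.

End ChainSum.

Section BernoulliBound.
Context {R : realType} {d n : nat}.
Local Notation site := (site d n).

(* [2 ^ #|A|] counts the subsets of [A], and [1 + x <= expR x]. *)
Lemma passage_time_indicator_le (B : {set site}) (a : R) :
  passage_time (fun v => (v \in B)%:R) * ln 2 <=
  a - 1 + expR (- a) * \sum_(S : {set site} | chain S) (S \subset B)%:R.
Proof.
have sum_ge g : g = finset.set0 \/ g \in directed_paths ->
    2 ^+ #|g :&: B|%SET <= \sum_(S : {set site} | chain S) (S \subset B)%:R :> R.
  move=> gP; rewrite -natrX -card_powerset -sum1_card natr_sum big_mkcond [leRHS]big_mkcond /=.
  apply: ler_sum => S _; rewrite powersetE finset.subsetI.
  have [/andP[Sg SB]|_] := boolP (_ && _); last by case: ifP.
  rewrite SB; case: gP => [g0|gP].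
    have -> : S = finset.set0 by apply/eqP; rewrite -finset.subset0 -g0.
    case: ifP => // /negP[]; apply/chainP => u v; by rewrite inE.
  by rewrite (chain_directed_path gP Sg).
have bound m : m%:R * ln 2 <= a - 1 + expR (- a) * 2 ^+ m :> R.
  have := expR_ge1Dx (m%:R * ln 2 - a); rewrite expRD expRM_natl lnK ?posrE//.
  rewrite mulrC; lra.
have [->|[g gP ->]] := passage_time_attained (fun v => (v \in B)%:R : R).
  rewrite mul0r (le_trans _ (_ : a - 1 + expR (- a) * 2 ^+ 0 <= _))//.
    by have := bound 0%N; rewrite mul0r.
  rewrite lerD2l ler_wpM2l ?expR_ge0//.
  have := sum_ge finset.set0 (or_introl erefl).
  by rewrite finset.set0I cards0.
have -> : path_weight (fun v => (v \in B)%:R) g = #|g :&: B|%SET%:R :> R.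
  rewrite -sum1_card natr_sum [RHS]big_mkcond /path_weight [LHS]big_mkcond.
  apply: eq_bigr => v _; rewrite inE; case: (v \in g) => //=.
  by case: (v \in B).
apply: (le_trans (bound _)); rewrite lerD2l ler_wpM2l ?expR_ge0//.
by apply: sum_ge; right.
Qed.

End BernoulliBound.

Lemma le_sum_indicators {R : realType} (y : R) N : y <= N%:R ->
  y <= \sum_(j < N) (j%:R < y)%R%:R.
Proof.
have minle M : Num.min y M%:R <= \sum_(j < M) (j%:R < y)%R%:R.
  elim: M => [|M ih]; first by rewrite big_ord0 ge_min lexx orbT.
  rewrite big_ord_recr /=; have [yM|] := boolP (y <= M%:R).
    rewrite ltNge yM addr0 (le_trans _ ih)// le_min.
    by rewrite !ge_min lexx yM.
  rewrite -ltNge => My; rewrite My (@le_trans _ _ (M%:R + 1))//; first by rewrite ge_min -natr1 lexx orbT.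
  by rewrite lerD2r (le_trans _ ih)// le_min lexx ltW.
by move=> yN; rewrite (le_trans _ (minle N))// le_min lexx.
Qed.

Lemma nneseries_le {R : realType} (u : nat -> \bar R) (M : \bar R) :
  (forall j, 0 <= u j)%E -> (forall N, \sum_(0 <= j < N) u j <= M)%E ->
  (\sum_(0 <= j <oo) u j <= M)%E.
Proof.
move=> u0 uM; apply: lime_le; first exact: is_cvg_nneseries.
by apply: nearW => N; apply: uM.
Qed.

Section Tail.
Context {R : realType}.
Variable F : probability (measurableTypeR R) R.
Hypothesis F_nonneg : F `[0, +oo[%classic = 1%E.
Variable d : nat.
Hypothesis d_gt0 : (0 < d)%N.
Hypothesis F_tail : (\int[lebesgue_measure]_(x in `[0%R, +oo[)
  ((1 - distribution_function F (Num.sqrt x)) `^ (d%:R^-1))%:E < +oo)%E.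

Definition upper_tail (x : R) : R := 1 - distribution_function F (Num.sqrt x).

Lemma distribution_functionE x : (distribution_function F x)%:E = F `]-oo, x]%classic.
Proof. by rewrite /distribution_function fineK// fin_num_measure. Qed.

Lemma distribution_function_le : {homo distribution_function F : x y / x <= y}.
Proof.
move=> x y xy; rewrite -lee_fin !distribution_functionE le_measure ?inE//.
exact: subitvPr.
Qed.

Lemma upper_tail_ge0 x : 0 <= upper_tail x.
Proof. by rewrite subr_ge0 -lee_fin distribution_functionE probability_le1. Qed.

Lemma upper_tail_le1 x : upper_tail x <= 1.
Proof. by rewrite gerBl -lee_fin distribution_functionE. Qed.

Lemma upper_tail_anti : {homo upper_tail : x y /~ x <= y}.
Proof.
by move=> x y xy; rewrite lerB// distribution_function_le// ler_wsqrtr.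
Qed.

Lemma measure_sqr_gt (x : R) : 0 <= x -> F [set y | x < y ^+ 2] = (upper_tail x)%:E.
Proof.
move=> x0; rewrite EFinB distribution_functionE.
have mS : measurable [set y : R | x < y ^+ 2].
  have -> : [set y : R | x < y ^+ 2] = [set: R] `&` (fun y => y ^+ 2) @^-1` `]x, +oo[.
    by rewrite setTI; apply/seteqP; split=> y /=; rewrite in_itv/= andbT.
  by apply: exprn_measurable.
pose N : set R := ~` `[0, +oo[%classic; pose A : set R := `]Num.sqrt x, +oo[%classic.
have mN : measurable N by apply: measurableC.
have mA : measurable A by exact: measurable_itv.
have F0 : F N = 0%E by rewrite probability_setC// F_nonneg subee.
rewrite -probability_setC// setCitvl -/A.
have sqrt_lt y : 0 <= y -> (Num.sqrt x < y) = (x < y ^+ 2).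
  move=> y0; rewrite -[X in _ = (X < _)](sqr_sqrtr x0).
  by rewrite ltr_pXn2r// ?nnegrE// sqrtr_ge0.
apply/eqP; rewrite eq_le; apply/andP; split.
  apply: (@le_trans _ _ (F (A `|` N))).
    apply: le_measure; rewrite ?inE//; first exact: measurableU.
    move=> y /= xy; have [y0|y0] := leP 0 y.
      by left; rewrite /A/= in_itv/= andbT sqrt_lt.
    by right; rewrite /N/= in_itv/= andbT leNgt y0.
  by rewrite -[leRHS]adde0 -F0; apply: measureU2.
apply: le_measure; rewrite ?inE//.
move=> y; rewrite /A /= in_itv/= andbT => xy.
by rewrite -sqrt_lt// ltW// (le_lt_trans _ xy)// sqrtr_ge0.
Qed.

Lemma sum_upper_tail_root : exists2 M : R, 0 <= M & forall N,
  \sum_(j < N) upper_tail j%:R `^ d%:R^-1 <= M.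
Proof.
pose g x : R := upper_tail x `^ d%:R^-1.
have g0 x : 0 <= g x by apply: powR_ge0.
have g_anti : {homo g : x y /~ x <= y}.
  move=> x y xy; apply: ge0_ler_powR; rewrite ?nnegrE ?upper_tail_ge0//.
  exact: upper_tail_anti.
pose D := `[0%R, +oo[%classic : set R.
have mD : measurable D by exact: measurable_itv.
have mg : measurable_fun D (EFin \o g).
  apply/measurable_EFinP; apply: nonincreasing_measurable.
    exact: measurable_itv.
  by move=> x y; apply: g_anti.
set J := (\int[lebesgue_measure]_(x in D) (g x)%:E)%E.
have J0 : (0 <= J)%E by apply: integral_ge0 => x _; rewrite lee_fin.
have Jfin : J \is a fin_num by rewrite ge0_fin_numE.
have key N : \sum_(j < N) g j.+1%:R <= fine J.
  pose I_ j := `[j%:R, j.+1%:R[%classic : set R.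
  have mI j : measurable (I_ j) by exact: measurable_itv.
  rewrite -lee_fin fineK//.
  have -> : (\sum_(j < N) g j.+1%:R)%:E =
      (\int[lebesgue_measure]_(x in D) (\sum_(j < N) g j.+1%:R * \1_(I_ j) x)%:E)%E.
    under eq_integral do rewrite -sumEFin.
    rewrite ge0_integral_sum//; last 2 first.
    - move=> j; apply/measurable_EFinP/measurable_funM => //.
      by apply: measurable_indic; apply: mI.
    - by move=> j x _; rewrite lee_fin mulr_ge0.
    rewrite -sumEFin; apply: eq_bigr => j _.
    under eq_integral do rewrite EFinM.
    rewrite ge0_integralZl//; last 2 first.
    - by apply/measurable_EFinP; apply: measurable_indic; apply: mI.
    - by rewrite lee_fin.
    rewrite integral_indic//; last exact: mI.
    rewrite setIidl; last first.
      move=> x; rewrite /D /I_ /= !in_itv/= andbT => /andP[jx _].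
      by rewrite (le_trans _ jx).
    by rewrite /I_ /= lebesgue_measure_itv/= lte_fin ltr_nat leqnn -EFinB -natrB// subSnn mule1.
  apply: ge0_le_integral => //.
  - by move=> x _; rewrite lee_fin sumr_ge0// => j _; rewrite mulr_ge0.
  - apply/measurable_EFinP; apply: measurable_sum => j.
    by apply: measurable_funM => //; apply: measurable_indic; apply: mI.
  - move=> x; rewrite /D/= in_itv/= andbT => x0; rewrite lee_fin.
    apply: (@le_trans _ _ (g x * \sum_(j < N) ((j%:R <= x)%R%:R - (j.+1%:R <= x)%R%:R))).
      rewrite mulr_sumr; apply: ler_sum => j _; rewrite indicE /I_.
      have [/set_mem/=|/negP xI] := boolP (x \in _).
        rewrite in_itv/= => /andP[-> xj].
        rewrite [(j.+1%:R <= x)]leNgt xj subr0 !mulr1.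
        by apply: g_anti; apply: ltW.
      rewrite mulr0 mulr_ge0// subr_ge0 ler_nat.
      have [jx|//] := leP j.+1%:R x.
      by rewrite (le_trans _ jx)// ler_nat.
    rewrite -(big_mkord xpredT (fun j => (j%:R <= x)%R%:R - (j.+1%:R <= x)%R%:R : R)).
    rewrite (@telescope_sumr_eq _ _ _ (fun j => - (j%:R <= x)%R%:R)) => [|//|k _]; last first.
      by rewrite opprK addrC.
    rewrite x0 opprK ler_piMr// -[leRHS]add0r lerD2r oppr_le0 ler0n//.
have g01 : g 0 <= 1.
  rewrite /g -[leRHS](_ : 1 `^ d%:R^-1 = 1); last by rewrite powR1.
  by apply: ge0_ler_powR; rewrite ?nnegrE ?upper_tail_ge0 ?upper_tail_le1.
exists (1 + fine J); first by rewrite addr_ge0// fine_ge0.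
case=> [|N]; first by rewrite big_ord0 addr_ge0// fine_ge0.
rewrite big_ord_recl; apply: lerD; last first.
  rewrite (eq_bigr (fun j : 'I_N => g j.+1%:R)) => [|j _]; last by rewrite lift0.
  exact: key.
exact: g01.
Qed.

Lemma second_moment_lty : (\int[F]_x (x ^+ 2)%:E < +oo)%E.
Proof.
have [M M0 Mg] := sum_upper_tail_root.
pose u j (x : R) : R := (j%:R < x ^+ 2)%R%:R.
have mS (j : nat) : measurable [set x : R | j%:R < x ^+ 2].
  have -> : [set x : R | j%:R < x ^+ 2] = [set: R] `&` (fun y => y ^+ 2) @^-1` `]j%:R, +oo[.
    by rewrite setTI; apply/seteqP; split=> y /=; rewrite in_itv/= andbT.
  by apply: exprn_measurable.
have uE j : u j = \1_[set x : R | j%:R < x ^+ 2].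
  by apply/funext => x; rewrite indicE /u; congr (nat_of_bool _)%:R; apply/idP/idP; rewrite inE.
have mu_ j : measurable_fun [set: R] (fun x => (u j x)%:E).
  by apply/measurable_EFinP; rewrite uE; apply: measurable_indic.
have le_u x : ((x ^+ 2)%:E <= \sum_(0 <= j <oo) (u j x)%:E)%E.
  pose N := (Num.truncn (x ^+ 2)).+1.
  apply: le_trans (nneseries_lim_ge N _) => [|j _ _]; last by rewrite lee_fin.
  rewrite big_mkord sumEFin lee_fin; apply: le_sum_indicators.
  by rewrite ltW// truncnS_gt.
apply: (@le_lt_trans _ _ (\int[F]_x \sum_(0 <= j <oo) (u j x)%:E)%E).
  apply: ge0_le_integral => //.
  - by move=> x _; rewrite lee_fin sqr_ge0.
  - by apply/measurable_EFinP; apply: exprn_measurable.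
  - by apply: ge0_emeasurable_sum => [j x xD Pj|j Pj]; [rewrite lee_fin|apply: mu_].
rewrite integral_nneseries//; last by move=> j x _; rewrite lee_fin.
apply: (@le_lt_trans _ _ M%:E); last exact: ltry.
apply: nneseries_le => [j|N].
  by apply: integral_ge0 => x _; rewrite lee_fin.
rewrite big_mkord; apply: le_trans (_ : _ <= (\sum_(j < N) upper_tail j%:R `^ d%:R^-1)%:E)%E _; last first.
  by rewrite lee_fin.
rewrite -sumEFin; apply: lee_sum => j _.
rewrite (_ : (fun x : R => (u j x)%:E) = (EFin \o \1_[set x : R | j%:R < x ^+ 2])); last by rewrite -uE.
rewrite integral_indic//; last exact: mS.
rewrite setIT [leLHS](measure_sqr_gt (ler0n _ j)) lee_fin.
have [->|t0] := eqVneq (upper_tail j%:R) 0; first exact: powR_ge0.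
apply: ger1_powR; first by rewrite lt_neqAle eq_sym t0 upper_tail_ge0 upper_tail_le1.
by rewrite invf_le1 ?ltr0n// ler1n.
Qed.

End Tail.

Lemma measurable_bigmax {R : realType} d0 (T : measurableType d0) (J : Type)
    (r : seq J) (P : pred J) (x0 : T -> R) (h : J -> T -> R) :
  measurable_fun [set: T] x0 -> (forall j, measurable_fun [set: T] (h j)) ->
  measurable_fun [set: T] (fun x => \big[Num.max/x0 x]_(j <- r | P j) h j x).
Proof.
move=> m0 mh; elim: r => [|j r ih].
  by under eq_fun do rewrite big_nil.
have [Pj|/negbTE Pj] := boolP (P j).
  by under eq_fun do rewrite big_cons Pj; apply: measurable_maxr.
by under eq_fun do rewrite big_cons Pj.
Qed.

Lemma measurable_path_weight {R : realType} d0 (T : measurableType d0) d n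
    (w : site d n -> T -> R) g :
  (forall v, measurable_fun [set: T] (w v)) ->
  measurable_fun [set: T] (fun x => path_weight (w ^~ x) g).
Proof.
move=> mw; rewrite /path_weight.
under eq_fun do rewrite -big_filter.
by apply: measurable_sum.
Qed.

Lemma measurable_passage_time {R : realType} d0 (T : measurableType d0) d n
    (w : site d n -> T -> R) :
  (forall v, measurable_fun [set: T] (w v)) ->
  measurable_fun [set: T] (fun x => passage_time (w ^~ x)).
Proof.
by move=> mw; apply: measurable_bigmax => // g; apply: measurable_path_weight.
Qed.

Section TotalSize.
Context {R : realType} {V : finType}.
Local Notation I := (V + V + V)%type.
Local Notation config := (config R I).
Variables (mu : I -> probability (measurableTypeR R) R)
  (nu : probability config R).
Hypothesis nuE : product_law nu mu.
Variable F : probability (measurableTypeR R) R.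
Hypotheses (mu_old : forall v, mu (old v) = F) (mu_fresh : forall v, mu (fresh v) = F).
Hypothesis F_L2 : (\int[F]_x (x ^+ 2)%:E < +oo)%E.

Lemma integrable_coord_sqr i : mu i = F ->
  nu.-integrable [set: config] (fun z => (z i ^+ 2)%:E).
Proof.
move=> mui; apply/integrableP; split.
  by apply/measurable_EFinP; apply: measurable_funX; apply: measurable_coord.
under eq_integral do rewrite /= ger0_norm ?sqr_ge0//.
rewrite (ge0_integral_marginal nuE i (g := fun x => (x ^+ 2)%:E)) ?mui//.
  by apply/measurable_EFinP; apply: exprn_measurable.
by move=> x; rewrite lee_fin sqr_ge0.
Qed.

Lemma sqr_sum_le (J : finType) (a : J -> R) :
  (\sum_j a j) ^+ 2 <= #|J|%:R * \sum_j a j ^+ 2.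
Proof.
rewrite expr2 mulr_suml.
apply: (@le_trans _ _ (\sum_i \sum_j 2^-1 * (a i ^+ 2 + a j ^+ 2))).
  apply: ler_sum => i _; rewrite mulr_sumr; apply: ler_sum => j _.
  have := sqr_ge0 (a i - a j); rewrite sqrrB mulr2n; lra.
under eq_bigr do rewrite -mulr_sumr big_split/= sumr_const.
rewrite -mulr_sumr big_split/= sumr_const sumrMnl.
rewrite -[X in X + _]mulr_natl -[X in _ + X]mulr_natl; lra.
Qed.

Lemma total_size_L2 : (\int[nu]_z (total_size z ^+ 2)%:E < +oo)%E.
Proof.
pose h (z : config) : \bar R := (2%:E + \sum_v
  (4 * #|V|%:R)%:E * ((z (old v) ^+ 2)%:E + (z (fresh v) ^+ 2)%:E))%E.
have ih : nu.-integrable [set: config] h.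
  apply: integrableD => //; first by apply: finite_measure_integrable_cst.
  apply: integrable_sum => // v _; apply: integrableZl => //.
  by apply: integrableD => //; apply: integrable_coord_sqr.
have hE z : h z = (2 + \sum_v (4 * #|V|%:R) * (z (old v) ^+ 2 + z (fresh v) ^+ 2))%:E.
  by rewrite /h [RHS]EFinD -[in RHS]sumEFin.
have : nu.-integrable [set: config] (fun z => (total_size z ^+ 2)%:E).
  apply: le_integrable ih => //.
    by apply/measurable_EFinP; apply: measurable_funX; apply: measurable_total_size.
  move=> z _; rewrite hE /= lee_fin ger0_norm ?sqr_ge0// ger0_norm; last first.
    by rewrite addr_ge0// sumr_ge0// => v _; rewrite !mulr_ge0// addr_ge0// sqr_ge0.
  rewrite /total_size; set S := \sum_v (_ + _).
  have := sqr_sum_le (fun v => `|z (old v)| + `|z (fresh v)|); rewrite -/S => S2.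
  have {S2} S2' : S ^+ 2 <= \sum_v (2 * #|V|%:R) * (z (old v) ^+ 2 + z (fresh v) ^+ 2).
    apply: le_trans S2 _; rewrite mulr_sumr; apply: ler_sum => v _.
    rewrite -mulrA [leRHS]mulrCA ler_wpM2l//.
    rewrite -(real_normK (num_real (z (old v)))) -(real_normK (num_real (z (fresh v)))).
    have := sqr_ge0 (`|z (old v)| - `|z (fresh v)|).
    rewrite sqrrB sqrrD !mulr2n; lra.
  have : \sum_v 4 * #|V|%:R * (z (old v) ^+ 2 + z (fresh v) ^+ 2) =
      2 * \sum_v 2 * #|V|%:R * (z (old v) ^+ 2 + z (fresh v) ^+ 2).
    rewrite mulr_sumr; apply: eq_bigr => v _; lra.
  move=> ->; have := sqr_ge0 (S - 1); rewrite sqrrB sqrrD !mulr2n; lra.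
move=> /integrableP[_]; under eq_integral do rewrite /= ger0_norm ?sqr_ge0//.
by [].
Qed.

End TotalSize.

Section LinearGrowth.
Context {R : realType} {d n : nat}.
Hypotheses (d_gt0 : (0 < d)%N) (n_gt0 : (0 < n)%N).
Local Notation V := (site d n).
Local Notation I := (V + V + V)%type.
Local Notation config := (config R I).
Variables (mu : I -> probability (measurableTypeR R) R)
  (nu : probability config R).
Hypothesis nuE : product_law nu mu.
Variable F : probability (measurableTypeR R) R.
Hypotheses (mu_old : forall v, mu (old v) = F) (mu_fresh : forall v, mu (fresh v) = F).
Hypothesis F_L2 : (\int[F]_x (x ^+ 2)%:E < +oo)%E.

Let L2 := total_size_L2 nuE mu_old mu_fresh F_L2.

Local Notation mean h := (\int[nu]_z h z).

Lemma measurable_passage_time_old (g : R -> R) : measurable_fun [set: R] g ->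
  measurable_fun [set: config] (fun z => passage_time (fun v => g (z (old v)))).
Proof.
move=> mg.
apply: (@measurable_passage_time R _ config d n (fun v z => g (z (old v)))) => v.
exact: (measurableT_comp mg (measurable_coord (old v))).
Qed.

Lemma mean_passage_time_indicator (B : set R) (q : R) : measurable B ->
  0 <= q -> F B = (q ^+ d)%:E ->
  mean (fun z => passage_time (fun v => \1_B (z (old v)))) <=
    d%:R * d.+2%:R / ln 2 * n%:R * q.
Proof.
move=> mB q0 FB; have ln2 : 0 < ln 2 :> R by rewrite ln_gt0// ltr1n.
pose rect (S : {set V}) : set config := rectangle (fun i : I =>
  if i is inl (inl v) then if v \in S then B else setT else setT).
have mrect S : measurable (rect S).
  by apply: measurable_rectangle => -[[]|] v //; case: ifP.
have rectE S : fine (nu (rect S)) = (q ^+ d) ^+ #|S|.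
  rewrite [nu _]nuE; last by case=> [[]|] v //; case: ifP.
  rewrite big_sumType/= big_sumType/=.
  rewrite [X in (_ * X)%E]big1 => [|v _]; last by rewrite probability_setT.
  rewrite [X in (_ * X * _)%E]big1 => [|v _]; last by rewrite probability_setT.
  rewrite !mule1 (eq_bigr (fun v => if v \in S then (q ^+ d)%:E else 1%E)) => [|v _]; last first.
    by rewrite -/(old v) mu_old; case: ifP; rewrite ?FB ?probability_setT.
  by rewrite -big_mkcond prodEFin /= prodr_const.
have sumE (z : config) : \sum_(S : {set V} | chain S) (S \subset [set v | z (old v) \in B]%SET)%:R =
    \sum_(S : {set V} | chain S) \1_(rect S) z :> R.
  apply: eq_bigr => S _; rewrite indicE; congr (nat_of_bool _)%:R.
  apply/fintype.subsetP/idP => [SB|/set_mem zS v vS].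
    apply/mem_set => -[[]|] v //=; case: ifP => // /SB.
    by rewrite inE => /set_mem.
  by rewrite inE; apply/mem_set; have := zS (old v); rewrite /= vS.
have m1 S : measurable_fun [set: config] (\1_(rect S) : _ -> R).
  exact: measurable_indic.
have q1 S : quad_growth (\1_(rect S) : config -> R).
  apply: (bounded_quad_growth (a := 1)) => // z.
  by rewrite indicE ger0_norm// lern1 leq_b1.
have mean1 S : mean (\1_(rect S)) = (q ^+ d) ^+ #|S|.
  by rewrite -rectE /Rintegral integral_indic// setIT.
pose a : R := d%:R * (d.+2%:R * n%:R * q).
pose T (z : config) : R := passage_time (fun v => \1_B (z (old v))).
have T0 z : 0 <= T z by apply: passage_time_ge0.
have qT : quad_growth T.
  apply: (bounded_quad_growth (a := #|V|%:R)).
    by apply: measurable_passage_time_old; apply: measurable_indic.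
  move=> z; rewrite ger0_norm//; apply: le_trans (passage_time_le_sum _) _.
  rewrite -sum1_card natr_sum; apply: ler_sum => v _.
  by rewrite indicE ger0_norm// lern1 leq_b1.
have le_T : mean (fun z => ln 2 * T z) <= mean (fun z => (a - 1) +
    expR (- a) * \sum_(S : {set V} | chain S) \1_(rect S) z).
  have qc : quad_growth (fun _ : config => a - 1) by apply/lin_quad_growth/lin_growth_cst.
  have qs : quad_growth (fun z : config => \sum_(S : {set V} | chain S) (\1_(rect S) z : R)).
    by apply: quad_growth_sum.
  apply: (le_mean L2) => [||z].
  - exact: quad_growthZ.
  - by apply: quad_growthD => //; apply: quad_growthZ.
  have := passage_time_indicator_le [set v | z (old v) \in B]%SET a.
  rewrite sumE mulrC; apply: le_trans; rewrite le_eqVlt; apply/orP; left; apply/eqP.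
  congr (_ * passage_time _); apply/funext => v; rewrite indicE inE; done.
have sumS : mean (fun z => (a - 1) + expR (- a) * \sum_(S : {set V} | chain S) \1_(rect S) z) <= a.
  rewrite (meanD L2); [|exact/lin_quad_growth/lin_growth_cst|
    by apply: quad_growthZ; apply: quad_growth_sum].
  rewrite mean_cst (meanZ L2); last exact: quad_growth_sum.
  rewrite (mean_sum L2)//.
  rewrite (eq_bigr (fun S : {set V} => (q ^+ d) ^+ #|S|)) => [|S _]; last exact: mean1.
  have := sum_chains_le d_gt0 n_gt0 q0.
  move=> /(ler_wpM2l (expR_ge0 (- a))); rewrite -expRM_natl -/a -expRD addNr expR0.
  lra.
have := le_trans le_T sumS; rewrite (meanZ L2)// -/T => leT.
rewrite (_ : _ * q = a / ln 2); last by rewrite /a; field; rewrite gt_eqF.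
by rewrite ler_pdivlMr// mulrC.
Qed.

Variable M : R.
Hypothesis F_nonneg : F `[0, +oo[%classic = 1%E.
Hypothesis M_ge : forall N, \sum_(j < N) upper_tail F j%:R `^ d%:R^-1 <= M.

Lemma mean_passage_time_sqr :
  mean (fun z => passage_time (fun v => z (old v) ^+ 2)) <=
    d%:R * d.+2%:R / ln 2 * M * n%:R.
Proof.
pose C : R := d%:R * d.+2%:R / ln 2.
have C0 : 0 <= C by rewrite divr_ge0 ?mulr_ge0// ln_ge0// ler1n.
pose B (j : nat) : set R := [set x | j%:R < x ^+ 2].
have mB j : measurable (B j).
  have -> : B j = [set: R] `&` (fun y => y ^+ 2) @^-1` `]j%:R, +oo[.
    by rewrite setTI; apply/seteqP; split=> y /=; rewrite in_itv/= andbT.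
  by apply: exprn_measurable.
pose T (z : config) := passage_time (fun v => z (old v) ^+ 2).
pose Tj j (z : config) : R := passage_time (fun v => \1_(B j) (z (old v))).
have Tj0 j z : 0 <= Tj j z by apply: passage_time_ge0.
have mT : measurable_fun [set: config] T.
  by apply: (measurable_passage_time_old (g := fun x => x ^+ 2)); apply: exprn_measurable.
have mTj j : measurable_fun [set: config] (Tj j).
  by apply: measurable_passage_time_old; apply: measurable_indic.
have qTj j : quad_growth (Tj j).
  apply: (bounded_quad_growth (a := #|V|%:R)) => // z.
  rewrite ger0_norm//; apply: le_trans (passage_time_le_sum _) _.
  rewrite -sum1_card natr_sum; apply: ler_sum => v _.
  by rewrite indicE ger0_norm// lern1 leq_b1.
have le_T z : ((T z)%:E <= \sum_(0 <= j <oo) (Tj j z)%:E)%E.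
  pose N := \max_v (Num.truncn (z (old v) ^+ 2)).+1.
  apply: le_trans (nneseries_lim_ge N _) => [|j _ _]; last by rewrite lee_fin.
  rewrite big_mkord sumEFin lee_fin; apply: passage_time_le => [|g gP].
    exact: sumr_ge0.
  apply: (@le_trans _ _ (\sum_(j < N) path_weight (fun v => \1_(B j) (z (old v))) g)).
    rewrite /path_weight exchange_big/=; apply: ler_sum => v _.
    apply: le_trans (le_sum_indicators (N := N) _) _.
      rewrite (le_trans (ltW (truncnS_gt _)))// ler_nat.
      exact: (leq_bigmax (F := fun v => (Num.truncn (z (old v) ^+ 2)).+1)).
    rewrite le_eqVlt; apply/orP; left; apply/eqP; apply: eq_bigr => j _.
    rewrite indicE; congr (nat_of_bool _)%:R; apply/idP/idP.
      by move=> h; apply/mem_set.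
    by move=> /set_mem.
  by apply: ler_sum => j _; apply: path_weight_le.
rewrite -lee_fin; apply: le_trans (_ : _ <= (\int[nu]_z (T z)%:E))%E _.
  rewrite /Rintegral; set J := (\int[nu]_z _)%E.
  have : (0 <= J)%E by apply: integral_ge0 => z _; rewrite lee_fin passage_time_ge0.
  by case: J => //= r; rewrite ?leey ?lexx.
apply: (@le_trans _ _ (\int[nu]_z \sum_(0 <= j <oo) (Tj j z)%:E)%E).
  apply: ge0_le_integral => //.
  - by move=> z _; rewrite lee_fin passage_time_ge0.
  - exact/measurable_EFinP.
  - by apply: ge0_emeasurable_sum => [j x xD Pj|j Pj]; [rewrite lee_fin|apply/measurable_EFinP].
rewrite integral_nneseries//; last 2 first.
- by move=> j; apply/measurable_EFinP.
- by move=> j x _; rewrite lee_fin.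
apply: nneseries_le => [j|N].
  by apply: integral_ge0 => x _; rewrite lee_fin.
rewrite big_mkord.
apply: le_trans (_ : _ <= (\sum_(j < N) C * n%:R * upper_tail F j%:R `^ d%:R^-1)%:E)%E _; last first.
  by rewrite lee_fin -mulr_sumr -/C -[leRHS]mulrA [M * _]mulrC mulrA ler_wpM2l// mulr_ge0.
rewrite -sumEFin; apply: lee_sum => j _.
rewrite (mean_fin L2)// lee_fin; apply: mean_passage_time_indicator => //.
  exact: powR_ge0.
rewrite measure_sqr_gt//; congr (_%:E).
rewrite -powR_mulrn ?powR_ge0// -powRrM mulVf ?pnatr_eq0 -?lt0n//.
by rewrite powRr1// upper_tail_ge0.
Qed.

End LinearGrowth.

Section Stability.
Context {R : realType} {d n : nat}.
Local Notation V := (site d n).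
Local Notation I := (V + V + V)%type.
Local Notation config := (config R I).
Implicit Types z : config.

Definition old_time z : R := passage_time (fun v => z (old v)).

Lemma old_time_resample1 v z : old_time (resample [set v]%SET z) =
  passage_time (update (fun u => z (old u)) (fun u => z (fresh u)) v).
Proof.
congr passage_time; apply/funext => u; rewrite /resample /reindex_config /update /=.
by rewrite inE; case: eqP.
Qed.

Lemma lin_growth_old_time : lin_growth old_time.
Proof.
split; first exact: (measurable_passage_time_old (g := id)).
exists 1 => z; rewrite mul1r ger0_norm ?passage_time_ge0//.
apply: (le_trans (passage_time_le_sum _)); rewrite /total_size -[leLHS]add0r.
by apply: lerD => //; apply: ler_sum => v _; rewrite lerDl.
Qed.

Lemma no_fresh_old_time A : no_fresh A old_time.
Proof.
move=> z z' zz'; congr passage_time; apply/funext => v; apply: zz' => u _.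
by apply/eqP.
Qed.

Variables (mu : I -> probability (measurableTypeR R) R)
  (nu : probability config R).
Hypothesis nuE : product_law nu mu.
Hypothesis mu_fresh : forall v, mu (fresh v) = mu (old v).
Hypothesis L2 : (\int[nu]_z (total_size z ^+ 2)%:E < +oo)%E.

Local Notation mean h := (\int[nu]_z h z).

Lemma quad_growth_old_time_sqr :
  quad_growth (fun z => passage_time (fun v => z (old v) ^+ 2)).
Proof.
split.
  by apply: (measurable_passage_time_old (g := fun x => x ^+ 2)); apply: exprn_measurable.
exists 1 => z; rewrite mul1r ger0_norm ?passage_time_ge0//.
apply: (le_trans (passage_time_le_sum _)); rewrite /total_size.
have S0 : 0 <= \sum_v (`|z (old v)| + `|z (fresh v)|).
  by apply: sumr_ge0 => v _; rewrite addr_ge0.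
apply: (@le_trans _ _ ((\sum_v (`|z (old v)| + `|z (fresh v)|)) ^+ 2)); last first.
  by rewrite lerXn2r ?nnegrE ?addr_ge0// lerDr.
rewrite expr2 mulr_suml; apply: ler_sum => v _.
rewrite normrX expr2; apply: ler_pM => //; first by rewrite lerDl.
rewrite (bigD1 v)//= -[leLHS]addr0 -addrA.
apply: lerD => //; apply: addr_ge0 => //; apply: sumr_ge0 => u _.
exact: addr_ge0.
Qed.

Lemma sum_resampled_moment_le :
  \sum_v 2^-1 * resampled_moment nu (increment v old_time) finset.set0 <=
  4 * mean (fun z => passage_time (fun v => z (old v) ^+ 2)).
Proof.
pose D v z := increment v old_time z.
pose p v z := Num.max 0 (D v z) ^+ 2.
have lD v : lin_growth (D v) by apply/lin_growth_increment/lin_growth_old_time.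
have lp v : lin_growth (fun z => Num.max 0 (D v z)).
  have [mD [K DK]] := lD v; split; first exact: measurable_maxr.
  by exists K => z; apply: le_trans (DK z); rewrite /Num.max; case: ifP; rewrite ?normr0.
have qp v : quad_growth (p v) by apply: lin_growthM.
have DN v z : D v (resample [set v]%SET z) = - D v z.
  by rewrite /D /increment resampleK opprB.
have half v : 2^-1 * resampled_moment nu (increment v old_time) finset.set0 = mean (p v).
  have -> : resampled_moment nu (increment v old_time) finset.set0 =
      mean (fun z => p v z + (p v \o resample [set v]%SET) z).
    apply: eq_Rintegral => z _; rewrite resample0 /= /p DN -/(D v z) /Num.max oppr_gt0.
    by have [] := ltgtP 0 (D v z) => [h|h|<-]; rewrite ?expr0n ?oppr0/=; ring.
  rewrite (meanD L2)//; last exact: quad_growth_resample.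
  by rewrite (mean_resample nuE mu_fresh L2)//; field.
rewrite (eq_bigr _ (fun v _ => half v)) -(mean_sum L2)//.
pose Q z := passage_time (fun v => z (old v) ^+ 2).
have qQ : quad_growth Q := quad_growth_old_time_sqr.
have -> : 4 * mean Q = mean (fun z => 2 * Q z + 2 * (Q \o resample [set: V]%SET) z).
  rewrite (meanD L2) ?(meanZ L2) ?(mean_resample nuE mu_fresh L2)//.
  - by lra.
  - exact: quad_growth_resample.
  - exact: quad_growthZ.
  - by apply: quad_growthZ; apply: quad_growth_resample.
apply: (le_mean L2) => [||z].
- exact: quad_growth_sum.
- by apply: quad_growthD; apply: quad_growthZ => //; apply: quad_growth_resample.
have := sum_passage_time_drop (fun v => z (old v)) (fun v => z (fresh v)).
rewrite /Q /= /resample /reindex_config /=.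
move=> h; apply: le_trans (le_trans h _).
  apply: ler_sum => v _; rewrite /p /D /increment old_time_resample1 -/(old_time z).
  by [].
rewrite lerD2l ler_wpM2l// le_eqVlt; apply/orP; left; apply/eqP; congr passage_time.
by apply/funext => v; rewrite inE.
Qed.

End Stability.

Section ConditionalVariance.
Context {R : realType}.
Local Open Scope ereal_scope.

Lemma ge0_integral_mrestr d0 (T : measurableType d0) (m : {measure set T -> \bar R})
    (D : set T) (mD : measurable D) (g : T -> \bar R) :
  measurable_fun [set: T] g -> (forall x, 0 <= g x) ->
  \int[mrestr m mD]_x g x = \int[m]_(x in D) g x.
Proof.
move=> mg g0; rewrite -(setUv D) ge0_integral_setU//=; first last.
- exact/disj_setPCl.
- by rewrite setUv.
- exact: measurableC.
rewrite [X in _ + X](null_set_integral (mu := mrestr m mD)) ?adde0//.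
- apply: eq_measure_integral => A mA AD /=.
  by rewrite /mrestr setIidl.
- exact: measurableC.
- exact: measurable_funTS.
- by rewrite /= /mrestr setICl measure0.
Qed.

Lemma variance_le_sqr_dist (m : probability (measurableTypeR R) R) (b : R) :
  \int[m]_x (x ^+ 2)%:E < +oo -> 'V_m[idfun] <= \int[m]_x ((x - b) ^+ 2)%:E.
Proof.
move=> m2.
have i2 : m.-integrable [set: R] (fun x => (x ^+ 2)%:E).
  apply/integrableP; split; first by apply/measurable_EFinP; apply: exprn_measurable.
  by under eq_integral do rewrite /= ger0_norm ?sqr_ge0//.
have ic (a : R) : m.-integrable [set: R] (fun x : R => a%:E).
  exact: finite_measure_integrable_cst.
have i1 : m.-integrable [set: R] (fun x : R => x%:E).
  have ii : m.-integrable [set: R] (fun x : R => 1%:E + (x ^+ 2)%:E) by apply: integrableD.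
  apply: le_integrable ii => //; first by apply/measurable_EFinP; apply: measurable_id.
  move=> x _ /=; rewrite lee_fin [leRHS]ger0_norm ?addr_ge0 ?sqr_ge0//.
  rewrite -(real_normK (num_real x)); have := sqr_ge0 (`|x| - 1)%R.
  by have := sqr_ge0 (`|x|)%R; rewrite sqrrB mulr1 expr1n mulr2n; lra.
pose e := fine 'E_m[idfun].
have eE : \int[m]_x x%:E = e%:E.
  by rewrite /e unlock fineK//; apply: integrable_fin_num.
have sqE a : \int[m]_x ((x - a) ^+ 2)%:E =
    (fine (\int[m]_x (x ^+ 2)%:E) - 2 * a * e + a ^+ 2)%:E.
  have -> : (fun x : R => ((x - a) ^+ 2)%:E) =
      (fun x => (x ^+ 2)%:E + ((- 2 * a)%:E * x%:E + (a ^+ 2)%:E)).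
    by apply/funext => x; rewrite -EFinM -!EFinD; congr EFin; ring.
  rewrite integralD//; last by apply: integrableD => //; apply: integrableZl.
  rewrite integralD//; last exact: integrableZl.
  rewrite integralZl// eE integral_cst// [X in _ + (_ + _ * X)](probability_setT m) mule1.
  rewrite -[X in X + _]fineK; last by apply: integrable_fin_num.
  by rewrite -EFinM -!EFinD; congr EFin; ring.
have -> : 'V_m[idfun] = \int[m]_x ((x - e) ^+ 2)%:E.
  by rewrite /variance covariance.unlock /e expectation.unlock.
rewrite !sqE lee_fin; have := sqr_ge0 (b - e)%R; rewrite sqrrB mulr2n; lra.
Qed.

Variable F : probability (measurableTypeR R) R.
Hypothesis F_L2 : \int[F]_x (x ^+ 2)%:E < +oo.

Lemma integral_law_above k (g : R -> \bar R) : 0 < F `]k, +oo[%classic ->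
  measurable_fun [set: R] g -> (forall x, 0 <= g x) ->
  \int[law_above F k]_x g x =
  (fine (F `]k, +oo[%classic))^-1%:E * \int[F]_(x in `]k, +oo[%classic) g x.
Proof.
move=> Fk mg g0; set D := `]k, +oo[%classic.
have r0 : (0 <= (fine (F D))^-1)%R by rewrite invr_ge0 fine_ge0.
pose r := NngNum r0.
pose mD : measurable D := measurable_itv `]k, +oo[.
rewrite (eq_measure_integral (mscale r (mrestr F mD))) => [|A mA _].
  by rewrite ge0_integral_mscale// ge0_integral_mrestr.
rewrite /law_above /= /mnormalize /mscale /= /mrestr setTI.
rewrite gt_eqF//= lt_eqF; last by rewrite (le_lt_trans (probability_le1 _ _)) ?ltry.
by rewrite muleC.
Qed.

Variable c : R.
Hypothesis c_gt0 : (0 < c)%R.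
Hypothesis F_above : forall k : R, (0 <= k)%R ->
  0 < F `]k, +oo[%classic /\ c%:E < variance_above F k.

Let measurable_sqr_dist (b : R) : measurable_fun [set: R] (fun x : R => ((x - b) ^+ 2)%:E).
Proof. by apply/measurable_EFinP; apply: measurable_funX; apply: measurable_funB. Qed.

Lemma sqr_dist_open_ray k b : (0 <= k)%R ->
  c%:E * F `]k, +oo[%classic <= \int[F]_(x in `]k, +oo[%classic) ((x - b) ^+ 2)%:E.
Proof.
move=> k0; have [Fk cV] := F_above k0.
have Ffin : F `]k, +oo[%classic \is a fin_num by apply: fin_num_measure.
have : c%:E <= \int[law_above F k]_x ((x - b) ^+ 2)%:E.
  apply/ltW/(lt_le_trans cV)/variance_le_sqr_dist.
  rewrite integral_law_above//; last 2 first.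
  - by apply/measurable_EFinP; apply: exprn_measurable.
  - by move=> x; rewrite lee_fin sqr_ge0.
  rewrite lte_mul_pinfty ?lee_fin ?invr_ge0 ?fine_ge0//.
  apply: le_lt_trans F_L2; apply: ge0_subset_integral => //.
  - by apply/measurable_EFinP; apply: exprn_measurable.
  - by move=> x _; rewrite lee_fin sqr_ge0.
rewrite integral_law_above//; last by move=> x; rewrite lee_fin sqr_ge0.
pose p := fine (F `]k, +oo[%classic); have FE : F `]k, +oo[%classic = p%:E by rewrite fineK.
have p0 : (0 < p)%R by rewrite -lte_fin -FE.
rewrite FE /=.
by rewrite lee_pdivlMl// muleC.
Qed.

(* Let the open rays `]k, +oo[ decrease to `[m, +oo[. *)
Lemma sqr_dist_closed_ray m b : (0 < m)%R ->
  c%:E * F `[m, +oo[%classic <= \int[F]_(x in `[m, +oo[%classic) ((x - b) ^+ 2)%:E.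
Proof.
move=> m0; set D := `[m, +oo[%classic; set J := \int[F]_(x in D) _.
pose k (j : nat) : R := (m - m / j.+1%:R)%R.
have k0 j : (0 <= k j)%R.
  by rewrite subr_ge0 ler_pdivrMr// ler_peMr ?ler1n// ltW.
have km j : (k j < m)%R by rewrite ltrBlDr ltrDl divr_gt0.
pose A j : set R := `]k j, m[%classic.
pose L : R := ((m + `|b|) ^+ 2)%R.
have mA j : measurable (A j) by exact: measurable_itv.
have le_j j : c%:E * F D <= L%:E * F (A j) + J.
  apply: (@le_trans _ _ (c%:E * F `]k j, +oo[%classic)).
    rewrite lee_pmul2l// le_measure ?inE//; try exact: measurable_itv.
    by move=> x; rewrite /D /= !in_itv/= !andbT; apply: lt_le_trans.
  apply: le_trans (sqr_dist_open_ray b (k0 j)) _.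
  have -> : (`]k j, +oo[ = A j `|` D)%classic.
    by rewrite /A /D -itv_bndbnd_setU// bnd_simp// ltW.
  rewrite ge0_integral_setU//=; first last.
  - apply/disj_setPS => x []; rewrite /A /D /= !in_itv/= andbT => /andP[_ xm] mx.
    by move: xm; rewrite ltNge mx.
  - by move=> x _; rewrite lee_fin sqr_ge0.
  - by apply: measurable_funTS; apply: measurable_sqr_dist.
  - exact: measurable_itv.
  - exact: measurable_itv.
  rewrite leeD2r// -integral_cst; last exact: measurable_itv.
  apply: ge0_le_integral => //.
  - exact: measurable_itv.
  - by move=> x _; rewrite lee_fin sqr_ge0.
  - by apply: measurable_funTS; apply: measurable_sqr_dist.
  move=> x; rewrite /A /= in_itv/= => /andP[kx xm]; rewrite lee_fin /L.
  rewrite -(real_normK (num_real (x - b))).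
  apply: lerXn2r; rewrite ?nnegrE ?addr_ge0 ?(ltW m0)//.
  rewrite (le_trans (ler_normB _ _))// lerD2r ger0_norm; first exact: ltW.
  exact: le_trans (k0 j) (ltW kx).
have A0 : F (A j) @[j --> \oo] --> 0.
  rewrite -(measure0 F) (_ : set0 = \bigcap_j A j).
    apply: nonincreasing_cvg_mu.
    - apply: (@le_lt_trans _ _ 1%E); last exact: ltry.
      by apply: probability_le1; apply: measurable_itv.
    - by move=> i; apply: measurable_itv.
    - by apply: bigcapT_measurable => i; apply: measurable_itv.
    move=> i j ij; apply/subsetPset => x; rewrite /A /= !in_itv/= => /andP[kx ->].
    rewrite andbT (le_lt_trans _ kx)// lerD2l lerN2 ler_pM2l//.
    by rewrite lef_pV2 ?posrE// ler_nat.
  apply/seteqP; split => // x Ax.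
  have xm : (x < m)%R by have := Ax 0%N I; rewrite /A /= in_itv/= => /andP[].
  pose N := Num.truncn (m / (m - x))%R.
  have := Ax N I; rewrite /A /= in_itv/= => /andP[+ _].
  rewrite ltNge => /negP; apply; rewrite /k lerBrDr -lerBrDl.
  rewrite ler_pdivrMr// mulrC -ler_pdivrMr ?subr_gt0//.
  by rewrite ltW// truncnS_gt.
have J0 : 0 <= J by apply: integral_ge0 => x _; rewrite lee_fin sqr_ge0.
have [Joo|Joo] := eqVneq J +oo; first by rewrite Joo leey.
have Jfin : J \is a fin_num by rewrite ge0_fin_numE// ltey.
have cv : L%:E * F (A j) + J @[j --> \oo] --> L%:E * 0 + J.
  by apply: cvgeD; [rewrite mule0 fin_num_adde_defr|apply: cvgeZl|exact: cvg_cst].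
rewrite -[leRHS]add0e -[X in X + _](mule0 L%:E) -(cvg_lim _ cv)//.
apply: lime_ge; first by apply/cvg_ex; eexists; exact: cv.
by apply: nearW.
Qed.

(* For m <= 0 use the ray `]0, +oo[, whose mass is a positive fraction of that of
   `[m, +oo[. *)
Lemma positive_part_sqr_dist : exists2 c' : R, (0 < c')%R & forall m b : R,
  c'%:E * F `[m, +oo[%classic <= \int[F]_x ((Num.max 0 (x - m) - b) ^+ 2)%:E.
Proof.
have [F0 _] := F_above (lexx 0%R).
have F0fin : F `]0%R, +oo[%classic \is a fin_num by apply: fin_num_measure.
pose p := fine (F `]0%R, +oo[%classic).
have p0 : (0 < p)%R by rewrite -lte_fin fineK.
have p1 : (p <= 1)%R by rewrite -lee_fin fineK// probability_le1.
exists (c * p)%R; first exact: mulr_gt0.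
move=> m b.
have mphi : measurable_fun [set: R] (fun x => ((Num.max 0 (x - m) - b) ^+ 2)%:E).
  apply/measurable_EFinP; apply: measurable_funX; apply: measurable_funB => //.
  by apply: measurable_maxr => //; apply: measurable_funB.
have sub (D : set R) : measurable D -> (forall x, D x -> (m <= x)%R) ->
    \int[F]_(x in D) ((x - (m + b)) ^+ 2)%:E <=
    \int[F]_x ((Num.max 0 (x - m) - b) ^+ 2)%:E.
  move=> mD Dm; apply: le_trans (_ : _ <= \int[F]_(x in D) ((Num.max 0 (x - m) - b) ^+ 2)%:E) _.
    rewrite le_eqVlt; apply/orP; left; apply/eqP; apply: eq_integral => x /set_mem /Dm mx.
    by rewrite max_r ?subr_ge0// opprD addrA.
  by apply: ge0_subset_integral => // x _; rewrite lee_fin sqr_ge0.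
have [m0|m0] := ltP 0%R m.
  apply: le_trans (sub `[m, +oo[%classic _ _) => //; last first.
    by move=> x; rewrite /= in_itv/= andbT.
  apply: le_trans (sqr_dist_closed_ray (m + b) m0).
  by rewrite lee_wpmul2r// lee_fin ler_piMr// ltW.
apply: le_trans (sub `]0%R, +oo[%classic _ _) => //; last first.
  by move=> x; rewrite /= in_itv/= andbT => /ltW; apply: le_trans.
apply: le_trans (sqr_dist_open_ray (m + b) (lexx 0%R)).
rewrite EFinM -muleA; apply: lee_wpmul2l; first by rewrite lee_fin ltW.
rewrite /p fineK// -[leRHS]mule1; apply: lee_wpmul2l => //.
by apply: probability_le1; apply: measurable_itv.
Qed.

End ConditionalVariance.

Lemma positive_part_incr {R : realType} (k m x y : R) : k <= m -> y <= x ->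
  0 <= Num.max 0 (x - m) - Num.max 0 (y - m) <= Num.max 0 (x - k) - Num.max 0 (y - k).
Proof.
move=> km yx; have lt_max t : Num.max 0 t = if 0 < t then t else 0 by [].
by rewrite !lt_max; do 4 (case: ltP => ?); apply/andP; split; lra.
Qed.

Lemma positive_part_prod_ge {R : realType} (k k' x y : R) :
  (Num.max 0 (x - Num.max k k') - Num.max 0 (y - Num.max k k')) ^+ 2 <=
  (Num.max 0 (x - k) - Num.max 0 (y - k)) * (Num.max 0 (x - k') - Num.max 0 (y - k')).
Proof.
have km : k <= Num.max k k' by rewrite le_max lexx.
have k'm : k' <= Num.max k k' by rewrite le_max lexx orbT.
have [yx|/ltW xy] := leP y x.
  have /andP[h0 h1] := positive_part_incr km yx.
  by have /andP[_ h2] := positive_part_incr k'm yx; rewrite expr2 ler_pM.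
have /andP[h0 h1] := positive_part_incr km xy.
have /andP[_ h2] := positive_part_incr k'm xy.
by rewrite -sqrrN opprB -mulrNN !opprB expr2 ler_pM.
Qed.

Lemma measurable_bool_natr {R : realType} d0 (T : measurableType d0) (b : T -> bool) :
  measurable_fun [set: T] b -> measurable_fun [set: T] (fun x => (b x)%:R : R).
Proof.
move=> mb; rewrite (_ : (fun x => _) = fun x => if b x then 1 else 0).
  exact: measurable_fun_ifT.
by apply/funext => x; case: (b x).
Qed.

Section GeodesicMeasurability.
Context {R : realType} {d n : nat} d0 (T : measurableType d0).
Variable w : site d n -> T -> R.
Hypothesis mw : forall v, measurable_fun [set: T] (w v).

Lemma measurable_detour_time v :
  measurable_fun [set: T] (fun x => detour_time v (w ^~ x)).
Proof. by apply: measurable_bigmax => // g; apply: measurable_path_weight. Qed.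

Lemma measurable_through_time v g0 :
  measurable_fun [set: T] (fun x => through_time v g0 (w ^~ x)).
Proof. by apply: measurable_bigmax => [|g]; apply: measurable_path_weight. Qed.

Lemma measurable_mem_geodesic_sites v :
  measurable_fun [set: T] (fun x => v \in geodesic_sites (w ^~ x)).
Proof.
have [[g0 g0P vg0]|none] :=
    pselect (exists2 g, g \in @directed_paths d n & v \in g).
  under eq_fun do rewrite (mem_geodesic_sites g0P vg0).
  apply: measurable_fun_ler; first exact: measurable_detour_time.
  by apply: measurable_funD => //; apply: measurable_through_time.
rewrite (_ : (fun x => _) = fun=> false) //.
apply/funext => x; apply/negbTE/notin_geodesic_sites => g gP.
by apply/negP => vg; apply: none; exists g.
Qed.

End GeodesicMeasurability.

Section Influence.
Context {R : realType} {d n : nat}.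
Local Notation V := (site d n).
Local Notation I := (V + V + V)%type.
Local Notation config := (config R I).
Variables (mu : I -> probability (measurableTypeR R) R)
  (nu : probability config R).
Hypothesis nuE : product_law nu mu.
Variable F : probability (measurableTypeR R) R.
Hypotheses (mu_old : forall v, mu (old v) = F) (mu_fresh : forall v, mu (fresh v) = F).
Hypothesis F_L2 : (\int[F]_x (x ^+ 2)%:E < +oo)%E.
Variable c : R.
Hypothesis F_var : forall m b : R, (c%:E * F `[m, +oo[%classic <=
  \int[F]_x ((Num.max 0 (x - m) - b) ^+ 2)%:E)%E.

Let L2 := total_size_L2 nuE mu_old mu_fresh F_L2.
Let mu_same v : mu (fresh v) = mu (old v).
Proof. by rewrite mu_old mu_fresh. Qed.

Local Notation mean h := (\int[nu]_z h z).

Definition old_geodesic_sites (z : config) := geodesic_sites (fun v => z (old v)).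

Definition common_geodesic_site (v : V) (A : {set V}) (z : config) : bool :=
  (v \in old_geodesic_sites z) && (v \in old_geodesic_sites (resample A z)).

Lemma measurable_common_geodesic_site v A :
  measurable_fun [set: config] (common_geodesic_site v A).
Proof.
have m : measurable_fun [set: config] (fun z => v \in old_geodesic_sites z).
  apply: (@measurable_mem_geodesic_sites _ _ _ _ config (fun v z => z (old v))) => u.
  exact: measurable_coord.
by apply: measurable_and => //; apply: (measurableT_comp m (measurable_resample A)).
Qed.

Lemma quad_growth_bool (b : config -> bool) : measurable_fun [set: config] b ->
  quad_growth (fun z => (b z)%:R : R).
Proof.
move=> mb; apply: (bounded_quad_growth (a := 1)); first exact: measurable_bool_natr.
by move=> z; case: (b z); rewrite ?normr1 ?normr0.
Qed.

Section OnPath.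
Variables (v : V) (g0 : {set V}).
Hypotheses (g0P : g0 \in directed_paths) (vg0 : v \in g0).

Definition threshold (z : config) : R :=
  detour_time v (fun u => z (old u)) - through_time v g0 (fun u => z (old u)).

Lemma measurable_threshold : measurable_fun [set: config] threshold.
Proof.
apply: measurable_funB.
  apply: (@measurable_detour_time _ _ _ _ config (fun v z => z (old v))) => u.
  exact: measurable_coord.
apply: (@measurable_through_time _ _ _ _ config (fun v z => z (old v))) => u.
exact: measurable_coord.
Qed.

Lemma threshold_ext z z' : (forall u, u != v -> z (old u) = z' (old u)) ->
  threshold z = threshold z'.
Proof.
by move=> e; rewrite /threshold (detour_time_ext e) (through_time_ext _ e).
Qed.

Lemma old_time_threshold z : old_time z =
  detour_time v (fun u => z (old u)) + Num.max 0 (z (old v) - threshold z).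
Proof.
rewrite /old_time (passage_time_decomp g0P vg0) /threshold.
set a := detour_time _ _; set b := through_time _ _ _; set x := z _.
by rewrite opprB addrCA addrA addr_maxr addr0 addrC; congr (Num.max _ _); ring.
Qed.

Lemma mem_old_geodesic_sites z :
  (v \in old_geodesic_sites z) = (threshold z <= z (old v)).
Proof. by rewrite /old_geodesic_sites (mem_geodesic_sites g0P vg0) lerBlDl. Qed.

Lemma threshold_resample1 z : threshold (resample [set v]%SET z) = threshold z.
Proof.
by apply: threshold_ext => u uv; rewrite /resample /reindex_config /= inE (negbTE uv).
Qed.

Lemma increment_old_time z : increment v old_time z =
  Num.max 0 (z (old v) - threshold z) - Num.max 0 (z (fresh v) - threshold z).
Proof.
rewrite /increment !old_time_threshold threshold_resample1.
rewrite (@detour_time_ext _ _ _ _ _ (fun u => z (old u))) => [|u uv]; last first.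
  by rewrite /resample /reindex_config /= inE (negbTE uv).
have -> : resample [set v]%SET z (old v) = z (fresh v).
  by rewrite /resample /reindex_config /= inE eqxx.
ring.
Qed.

Variable B : {set V}.
Hypothesis vB : v \notin B.

Let k' z := threshold (resample B z).
Let m z := Num.max (threshold z) (k' z).

Let resampleB_old (z : config) : resample B z (old v) = z (old v).
Proof. by rewrite /resample /reindex_config /= (negbTE vB). Qed.

Let resampleB_fresh (z : config) : resample B z (fresh v) = z (fresh v).
Proof. by rewrite /resample /reindex_config /= (negbTE vB). Qed.

Let k'_resample1 (z : config) : k' (resample [set v]%SET z) = k' z.
Proof. by rewrite /k' resampleC// threshold_resample1. Qed.

Let mk' : measurable_fun [set: config] k'.
Proof. exact: (measurableT_comp measurable_threshold (measurable_resample B)). Qed.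

Let mm : measurable_fun [set: config] m.
Proof. by apply: measurable_maxr => //; apply: measurable_threshold. Qed.

Let m_merge (z w : config) : m (merge [set old v]%SET z w) = m z.
Proof.
have merge_ne i : i != old v -> merge [set old v]%SET z w i = z i.
  by move=> iv; rewrite /merge inE (negbTE iv).
have old_ne u : u != v -> old u != old v.
  by move=> uv; apply: contraNneq uv => -[->].
congr Num.max; apply: threshold_ext => u uv; first by apply/merge_ne/old_ne.
rewrite /resample /reindex_config /=; case: (u \in B); first exact: merge_ne.
exact/merge_ne/old_ne.
Qed.

Let G (z : config) : R := (Num.max 0 (z (old v) - m z) - Num.max 0 (z (fresh v) - m z)) ^+ 2.

Let qG : quad_growth G.
Proof.
split.
  apply: measurable_funX; apply: measurable_funB; apply: measurable_maxr => //;
    by apply: measurable_funB => //; apply: measurable_coord.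
exists 1 => z; rewrite mul1r ger0_norm ?sqr_ge0//.
rewrite /G -(real_normK (num_real (_ - _))) lerXn2r ?nnegrE//; first exact/ltW/total_size_gt0.
apply: (@le_trans _ _ (`|z (old v)| + `|z (fresh v)|)).
  have lt_max t : Num.max 0 t = if 0 < t then t else 0 by [].
  set x := z (old v); set y := z (fresh v); set t := m z.
  apply: (@le_trans _ _ `|x - y|); last exact: ler_normB.
  have [yx|/ltW xy] := leP y x.
    have /andP[h0 _] := positive_part_incr (lexx t) yx.
    rewrite !ger0_norm ?subr_ge0// -subr_ge0 // !lt_max.
    by do 2 (case: ltP => ?); lra.
  have /andP[h0 _] := positive_part_incr (lexx t) xy.
  rewrite distrC [leRHS]distrC !ger0_norm ?subr_ge0// -subr_ge0 // !lt_max.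
  by do 2 (case: ltP => ?); lra.
rewrite /total_size (bigD1 v)//= addrCA lerDl.
by apply: addr_ge0 => //; apply: sumr_ge0 => u _; apply: addr_ge0.
Qed.

Let mean_reached_le :
  c * mean (fun z : config => (m z <= z (old v))%R%:R) <= mean G.
Proof.
pose ind (z : config) : R := (m z <= z (old v))%R%:R.
have qind : quad_growth ind.
  by apply: quad_growth_bool; apply: measurable_fun_ler => //; apply: measurable_coord.
have qc : quad_growth (fun z => c * ind z) := quad_growthZ c qind.
rewrite -subr_ge0 -(meanZ L2)// -(meanB L2)// -lee_fin.
have qH : quad_growth (fun z => G z - c * ind z) by apply: quad_growthB.
rewrite (mean_merge nuE L2 [set old v]%SET qH).
apply: integral_ge0 => z _.
have qGz := quad_growth_mergel [set old v]%SET z qG.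
have qiz := quad_growth_mergel [set old v]%SET z qind.
rewrite (_ : \int[nu]_y _ = (mean (fun w => G (merge [set old v]%SET z w) -
    c * ind (merge [set old v]%SET z w)))%:E)%E; last first.
  by rewrite mean_fin//; apply: quad_growth_mergel qH.
rewrite lee_fin (meanB L2)//; last exact: quad_growthZ.
rewrite (meanZ L2)// subr_ge0 -lee_fin EFinM -!mean_fin//.
have merge_old (w : config) : merge [set old v]%SET z w (old v) = w (old v).
  by rewrite /merge inE eqxx.
have merge_fresh (w : config) : merge [set old v]%SET z w (fresh v) = z (fresh v).
  by rewrite /merge inE.
have -> : (\int[nu]_w ((G \o merge [set old v]%SET z) w)%:E =
    \int[F]_x ((Num.max 0 (x - m z) - Num.max 0 (z (fresh v) - m z)) ^+ 2)%:E)%E.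
  rewrite -(mu_old v) -(ge0_integral_marginal nuE)//.
  - by apply: eq_integral => w _; rewrite /= /G m_merge merge_old merge_fresh.
  - apply/measurable_EFinP; apply: measurable_funX; apply: measurable_funB => //.
    by apply: measurable_maxr => //; apply: measurable_funB.
  - by move=> x; rewrite lee_fin sqr_ge0.
have -> : (\int[nu]_w ((ind \o merge [set old v]%SET z) w)%:E = F `[m z, +oo[%classic)%E.
  rewrite -(mu_old v) -(marginal_law nuE)//.
  set E := [set _ | _].
  have mE : measurable (E : set config).
    by rewrite -[X in measurable X]setTI; apply: measurable_coord.
  transitivity (\int[nu]_w (\1_E w)%:E)%E; last by rewrite integral_indic// setIT.
  apply: eq_integral => w _; rewrite /= /ind m_merge merge_old indicE.
  congr (nat_of_bool _)%:R%:E; apply/idP/idP => [h|/set_mem]; last by rewrite /E /= in_itv/= andbT.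
  by apply/mem_set; rewrite /E /= in_itv/= andbT.
exact: F_var.
Qed.

Lemma common_geodesic_site_resampled :
  c * mean (fun z => (common_geodesic_site v B z)%:R) <=
    resampled_moment nu (increment v old_time) B.
Proof.
apply: (@le_trans _ _ (mean G)).
  have -> : mean (fun z => (common_geodesic_site v B z)%:R) =
      mean (fun z => (m z <= z (old v))%R%:R).
    apply: eq_Rintegral => z _; rewrite /common_geodesic_site !mem_old_geodesic_sites.
    by rewrite resampleB_old /m ge_max.
  exact: mean_reached_le.
have lD : lin_growth (increment v (@old_time R d n)).
  exact/lin_growth_increment/lin_growth_old_time.
apply: (le_mean L2) => // [|z].
  by apply: lin_growthM => //; apply: lin_growth_resample.
rewrite !increment_old_time resampleB_old resampleB_fresh.
exact: positive_part_prod_ge.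
Qed.

(* Replacing the old weight at [v] by the fresh one also in the second configuration,
   the site is common iff the weights x and y at [v] reach their respective
   thresholds, which implies that the one facing the larger threshold reaches
   both. *)
Lemma common_geodesic_site_resampledU1 : 0 <= c ->
  c * mean (fun z => (common_geodesic_site v (v |: B)%SET z)%:R) <=
    resampled_moment nu (increment v old_time) B.
Proof.
move=> c0; apply: le_trans common_geodesic_site_resampled; rewrite ler_wpM2l//.
pose i1 (z : config) := (k' z <= threshold z) && (m z <= z (old v)).
pose i2 (z : config) := (threshold z < k' z) && (m z <= z (old v)).
have mth := measurable_threshold.
have mo : measurable_fun [set: config] (fun z => m z <= z (old v)).
  by apply: measurable_fun_ler => //; apply: measurable_coord.
have q1 : quad_growth (fun z => (i1 z)%:R : R).
  by apply: quad_growth_bool; apply: measurable_and => //; apply: measurable_fun_ler.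
have q2 : quad_growth (fun z => (i2 z)%:R : R).
  by apply: quad_growth_bool; apply: measurable_and => //; apply: measurable_fun_ltr.
have -> : mean (fun z => (common_geodesic_site v B z)%:R) =
    mean (fun z => (i1 z)%:R + ((fun z => (i2 z)%:R) \o resample [set v]%SET) z).
  rewrite (meanD L2)//; last exact: quad_growth_resample.
  rewrite (mean_resample nuE mu_same L2)// -(meanD L2)//.
  apply: eq_Rintegral => z _; rewrite /common_geodesic_site !mem_old_geodesic_sites.
  rewrite resampleB_old -ge_max -/(k' z) -/(m z) /i1 /i2.
  by case: leP; case: (m z <= _); rewrite ?addr0 ?add0r.
apply: (le_mean L2) => [||z].
- by apply: quad_growth_bool; apply: measurable_common_geodesic_site.
- by apply: quad_growthD => //; apply: quad_growth_resample.
rewrite /common_geodesic_site resampleU1// !mem_old_geodesic_sites -/(k' _) k'_resample1.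
rewrite resampleB_old /= /i1 /i2 threshold_resample1 k'_resample1.
have -> : m (resample [set v]%SET z) = m z by rewrite /m threshold_resample1 k'_resample1.
set x := z (old v); set y := resample _ _ _.
rewrite /m ge_max ge_max; have [kk|kk] /= := leP (k' z) (threshold z).
  case: (leP (threshold z) x) => [tx|_] /=; last by rewrite addr0.
  by rewrite (le_trans kk tx) /=; case: (_ <= y); rewrite addr0.
case: (leP (k' z) y) => [ty|_]; last by rewrite !andbF add0r.
by rewrite (le_trans (ltW kk) ty) /= andbT add0r; case: (_ <= x).
Qed.

End OnPath.

Lemma common_geodesic_site_le v A : 0 <= c ->
  c * mean (fun z => (common_geodesic_site v A z)%:R) <=
    resampled_moment nu (increment v old_time) (A :\ v)%SET.
Proof.
move=> c0; have vA : v \notin (A :\ v)%SET by rewrite !inE eqxx.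
have [[g0 g0P vg0]|none] :=
    pselect (exists2 g, g \in @directed_paths d n & v \in g).
  have [inA|ninA] := boolP (v \in A).
    rewrite -{1}(finset.setD1K inA).
    exact: common_geodesic_site_resampledU1 g0P vg0 _ vA c0.
  have e : (A :\ v)%SET = A.
    by apply/setP => u; rewrite !inE; case: eqP => // ->; rewrite (negbTE ninA).
  by rewrite e; apply: common_geodesic_site_resampled g0P vg0 _ ninA.
have -> : mean (fun z => (common_geodesic_site v A z)%:R) = mean (fun=> 0).
  apply: eq_Rintegral => z _; rewrite /common_geodesic_site /old_geodesic_sites.
  rewrite (negbTE (notin_geodesic_sites _ _))// => g gP.
  by apply/negP => vg; apply: none; exists g.
rewrite mean_cst mulr0; apply: (resampled_moment_ge0 nuE mu_same L2).
  exact/lin_growth_increment/lin_growth_old_time.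
by apply: no_fresh_increment => //; apply: no_fresh_old_time.
Qed.

End Influence.

Lemma uniform_prob_ray {R : realType} (t : R) : 0 <= t <= 1 ->
  uniform_prob (@ltr01 R) `]-oo, t]%classic = t%:E.
Proof.
move=> /andP[t0 t1]; rewrite /uniform_prob integral_uniform_pdf.
have -> : (`]-oo, t] `&` `[0, 1] = `[0, t] :> set R)%classic.
  apply/seteqP; split => x /=; rewrite !in_itv/=.
    by move=> [-> /andP[-> _]].
  by move=> /andP[-> xt]; rewrite xt (le_trans xt).
rewrite (eq_integral (fun=> 1%:E)); last first.
  move=> x; rewrite inE/= in_itv/= => /andP[x0 xt].
  by rewrite /uniform_pdf x0 (le_trans xt t1)/= subr0 invr1.
rewrite integral_cst//= mul1e lebesgue_measure_itv/= lte_fin.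
have [->|tn0] := eqVneq t 0; first by rewrite ltxx.
by rewrite lt_neqAle eq_sym tn0 t0 sube0.
Qed.

Section Clocks.
Context {R : realType} {V : finType}.
Local Notation I := (V + V + V)%type.
Local Notation config := (config R I).
Variables (mu : I -> probability (measurableTypeR R) R)
  (nu : probability config R).
Hypothesis nuE : product_law nu mu.
Hypothesis mu_clock : forall v, mu (clock v) = uniform_prob (@ltr01 R).
Hypothesis L2 : (\int[nu]_z (total_size z ^+ 2)%:E < +oo)%E.

Local Notation mean h := (\int[nu]_z h z).

Definition active (t : R) (z : config) : {set V} := [set v | z (clock v) <= t]%SET.

Lemma measurable_active_eq t A : measurable [set z : config | active t z = A].
Proof.
pose D (i : I) : set R := if i is inr v then
  (if v \in A then `]-oo, t]%classic else `]t, +oo[%classic) else setT.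
have -> : [set z : config | active t z = A] = rectangle D.
  apply/seteqP; split => [z /= zA [[]|] v //=|z zD].
    by rewrite -zA inE; case: leP => tz; rewrite /= in_itv/= ?tz// andbT.
  apply/setP => v; rewrite inE; have := zD (clock v); rewrite /D /=.
  by case: (v \in A); rewrite /= in_itv/= ?andbT => tz; [rewrite tz|rewrite leNgt tz].
by apply: measurable_rectangle => -[[]|] v //=; case: ifP => _; apply: measurable_itv.
Qed.

Lemma quad_growth_active_eq t A : quad_growth (fun z => (active t z == A)%:R : R).
Proof.
apply: (bounded_quad_growth (a := 1)) => [|z]; last by case: eqP; rewrite ?normr1 ?normr0.
rewrite (_ : (fun z => _) = \1_[set z : config | active t z = A]).
  by apply: measurable_indic; apply: measurable_active_eq.
apply/funext => z; rewrite indicE; congr (nat_of_bool _)%:R.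
by apply/eqP/idP => [h|/set_mem//]; apply/mem_set.
Qed.

Lemma active_sum t (h : {set V} -> config -> R) z :
  h (active t z) z = \sum_A (active t z == A)%:R * h A z.
Proof.
rewrite (bigD1 (active t z))//= eqxx mul1r big1 ?addr0// => A.
by rewrite eq_sym => /negbTE ->; rewrite mul0r.
Qed.

Lemma quad_growth_active t (h : {set V} -> config -> R) :
  (forall A, quad_growth (h A)) -> quad_growth (fun z => h (active t z) z).
Proof.
move=> qh; under eq_fun do rewrite active_sum.
apply: quad_growth_sum => A _; apply: (quad_growth_bounded (a := 1)) => //.
  by have [] := quad_growth_active_eq t A.
by move=> z; case: eqP; rewrite ?normr1 ?normr0.
Qed.

Lemma quad_growth_active_fun t (phi : {set V} -> R) :
  quad_growth (fun z => phi (active t z)).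
Proof.
apply: (@quad_growth_active t (fun A _ => phi A)) => A.
exact/lin_quad_growth/lin_growth_cst.
Qed.

Definition clocks : {set I} := [set i | if i is inr _ then true else false]%SET.

Lemma mean_active t (h : {set V} -> config -> R) :
  (forall A, quad_growth (h A)) ->
  (forall A x y, h A (merge clocks x y) = h A x) ->
  mean (fun z => h (active t z) z) = mean (fun z => mean (h (active t z))).
Proof.
move=> qh hK; pose H A := mean (h A).
rewrite [RHS](_ : _ = mean (fun z => H (active t z)))//.
have q1 A (g : config -> R) : quad_growth g -> quad_growth (fun z => (active t z == A)%:R * g z).
  move=> qg; apply: (quad_growth_bounded (a := 1)) => //.
    by have [] := quad_growth_active_eq t A.
  by move=> z; case: eqP; rewrite ?normr1 ?normr0.
have qH A : quad_growth (fun _ : config => H A) by apply/lin_quad_growth/lin_growth_cst.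
under eq_Rintegral do rewrite active_sum.
under [RHS]eq_Rintegral do rewrite (active_sum t (fun A _ => H A)).
rewrite !(mean_sum L2); try by move=> A _; apply: q1.
apply: eq_bigr => A _; under eq_Rintegral do rewrite mulrC.
under [RHS]eq_Rintegral do rewrite mulrC.
rewrite (mean_indep nuE L2 (K := clocks))//.
- by rewrite (meanZ L2)//; apply: quad_growth_active_eq.
- exact: quad_growth_active_eq.
- by under eq_fun do rewrite mulrC; apply: q1.
move=> x y; congr (nat_of_bool (_ == _))%:R.
by apply/setP => v; rewrite !inE /merge inE.
Qed.

Lemma mean_mem_active t v (phi : {set V} -> R) : 0 <= t <= 1 ->
  (forall A, phi (A :\ v)%SET = phi A) ->
  mean (fun z => (v \in active t z)%:R * phi (active t z)) =
  t * mean (fun z => phi (active t z)).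
Proof.
move=> t01 phiv.
have qv : quad_growth (fun z => (v \in active t z)%:R : R).
  exact: (quad_growth_active_fun t (fun A => (v \in A)%:R)).
have qphi := quad_growth_active_fun t phi.
have meanv : mean (fun z => (v \in active t z)%:R) = t.
  have e : mu (clock v) `]-oo, t]%classic = t%:E.
    by rewrite mu_clock; apply: uniform_prob_ray.
  rewrite /Rintegral -[RHS]/(fine t%:E) -e.
  congr fine; rewrite -(marginal_law nuE)//; set E := [set _ | _].
  have mE : measurable (E : set config).
    by rewrite -[X in measurable X]setTI; apply: measurable_coord.
  transitivity (\int[nu]_w (\1_E w)%:E)%E; last by rewrite integral_indic// setIT.
  apply: eq_integral => z _; rewrite indicE inE; congr (nat_of_bool _)%:R%:E.
  by apply/idP/idP => [h|/set_mem]; [apply/mem_set|]; rewrite /E /= in_itv.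
under eq_Rintegral do rewrite mulrC.
rewrite (mean_indep nuE L2 (K := [set clock v]%SET))//.
- by rewrite meanv mulrC.
- under eq_fun do rewrite mulrC.
  exact: (quad_growth_active_fun t (fun A => (v \in A)%:R * phi A)).
- move=> x y; rewrite -phiv -[RHS]phiv; congr phi; apply/setP => u.
  by rewrite !inE /merge; have [//|uv] := eqVneq u v; rewrite /= inE; case: eqP => // -[] /eqP; rewrite (negbTE uv).
- by move=> x y; rewrite !inE /merge inE eqxx.
Qed.

Lemma ae_active0 : {ae nu, forall z, active 0 z = finset.set0}.
Proof.
have pos v : {ae nu, forall z : config, 0 < z (clock v)}.
  have mv : measurable [set z : config | `]-oo, 0%R]%classic (z (clock v))].
    by rewrite -[X in measurable X]setTI; apply: measurable_coord.
  exists [set z : config | `]-oo, 0%R]%classic (z (clock v))]; split => //.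
    by rewrite (marginal_law nuE)// mu_clock; apply: uniform_prob_ray; rewrite lexx ler01.
  by move=> z /= /negP; rewrite -leNgt in_itv.
apply: filterS (filter_forall _ pos) => z zpos.
by apply/setP => v; rewrite !inE leNgt zpos.
Qed.

End Clocks.

Section Dynamics.
Context {disp : measure_display} {Omega : measurableType disp} {R : realType}
  {P : probability Omega R} {d n : nat}.
Local Notation V := (site d n).
Local Notation I := (V + V + V)%type.
Local Notation config := (config R I).
Variables omega omega' U : V -> {RV P >-> R}.
Variable F : probability (measurableTypeR R) R.
Hypothesis env : dynamic_environment omega omega' U F.
Hypothesis F_L2 : (\int[F]_x (x ^+ 2)%:E < +oo)%E.

Definition environment (x : Omega) : config := fun i =>
  match i with
  | inl (inl v) => omega v x
  | inl (inr v) => omega' v x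
  | inr v => U v x
  end.

Definition marginal (i : I) : probability (measurableTypeR R) R :=
  match i with
  | inl _ => F
  | inr _ => uniform_prob (@ltr01 R)
  end.

Lemma measurable_environment : measurable_fun [set: Omega] environment.
Proof. by apply: measurable_config => -[[]|] v /=. Qed.

Definition environment_mfun : {mfun Omega >-> config} :=
  HB.pack environment (isMeasurableFun.Build _ _ _ _ environment measurable_environment).

Definition environment_law : probability config R := distribution P environment_mfun.
Local Notation nu := environment_law.
Local Notation mean h := (\int[nu]_z h z).

Lemma environment_lawE : product_law nu marginal.
Proof.
case: env => hom hom' hU indep A mA.
have := indep [set: I]%SET A (fun i _ => mA i).
have -> : \bigcap_(i in [set` [set: I]%SET])
    ((match i with inl (inl v) => omega v | inl (inr v) => omega' v
      | inr v => U v end : {RV P >-> R}) @^-1` A i) = environment @^-1` rectangle A.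
  apply/seteqP; split => [x xA [[]|] v|x xA [[]|] v _].
  - by have := xA (old v); rewrite /= inE; apply.
  - by have := xA (fresh v); rewrite /= inE; apply.
  - by have := xA (clock v); rewrite /= inE; apply.
  - exact: (xA (old v)).
  - exact: (xA (fresh v)).
  - exact: (xA (clock v)).
move=> h; rewrite [LHS]h; under eq_bigl do rewrite inE.
apply: eq_bigr => -[[]|] v _ /=.
- exact: (hom v _ (mA _)).
- exact: (hom' v _ (mA _)).
- exact: (hU v _ (mA _)).
Qed.

Let nuE := environment_lawE.
Let L2 : (\int[nu]_z (total_size z ^+ 2)%:E < +oo)%E.
Proof. by apply: (total_size_L2 nuE _ _ F_L2) => v. Qed.

Let mu_same v : marginal (fresh v) = marginal (old v). Proof. by []. Qed.
Let mu_clock v : marginal (clock v) = uniform_prob (@ltr01 R). Proof. by []. Qed.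

Lemma expectation_environment h : quad_growth h ->
  ('E_P[h \o environment] = (mean h)%:E)%E.
Proof.
move=> qh; rewrite -(mean_fin L2 qh) expectation.unlock.
rewrite [RHS](integral_law nuE (P := P) (phi := environment))//.
- split; first exact: measurable_environment.
  by move=> A mA; have := nuE mA.
- exact: quad_integrable.
Qed.

Definition time_at (t : R) (z : config) : R := old_time (resample (active t z) z).

Lemma resample_active t x v :
  resample (active t (environment x)) (environment x) (old v) =
  weights_at omega omega' U t x v.
Proof.
rewrite /resample /reindex_config /weights_at /= inE /=.
by rewrite leNgt; case: (t < U v x).
Qed.

Lemma passage_time_at_environment t :
  passage_time_at omega omega' U t = time_at t \o environment.
Proof.
apply/funext => x; congr passage_time; apply/funext => v.
by rewrite -resample_active.
Qed.

Lemma lin_growth_time_at t : lin_growth (time_at t).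
Proof.
split; last first.
  have [_ [K hK]] := @lin_growth_old_time R d n; exists K => z.
  by rewrite -(total_size_resample (active t z) z); apply: hK.
rewrite (_ : time_at t = fun z => passage_time
    (fun v => if t < z (clock v) then z (old v) else z (fresh v))); last first.
  apply/funext => z; congr passage_time; apply/funext => v.
  by rewrite /resample /reindex_config /= inE leNgt; case: (t < _).
apply: (@measurable_passage_time _ _ config _ _
  (fun v z => if t < z (clock v) then z (old v) else z (fresh v))) => v.
apply: measurable_fun_ifT.
- by apply: measurable_fun_ltr => //; apply: measurable_coord.
- exact: measurable_coord.
- exact: measurable_coord.
Qed.

Let clock_free (h : config -> R) := forall x y, h (merge clocks x y) = h x.

Let old_time_free A : clock_free (fun z => old_time (resample A z)).
Proof.
move=> x y; congr passage_time; apply/funext => v.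
rewrite /resample /reindex_config /merge /=; case: (v \in A);
  by rewrite /clocks inE.
Qed.

Let q_old A : quad_growth (fun z : config => old_time (resample A z)).
Proof. exact/lin_quad_growth/lin_growth_resample/lin_growth_old_time. Qed.

Definition mean_time : R := mean old_time.

Definition time_variance : R :=
  resampled_moment nu old_time finset.set0 - mean_time ^+ 2.

Lemma mean_time_at t : mean (time_at t) = mean_time.
Proof.
rewrite /time_at (mean_active nuE L2 t (h := fun A z => old_time (resample A z)))//.
rewrite (_ : (fun z => _) = fun=> mean_time); first exact: mean_cst.
apply/funext => z.
by apply: (mean_resample nuE mu_same L2 (active t z)); apply/lin_quad_growth/lin_growth_old_time.
Qed.

Lemma mean_time_at_sqr t :
  mean (fun z => time_at t z * time_at t z) = resampled_moment nu old_time finset.set0.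
Proof.
have qs : quad_growth (fun z : config => old_time z * old_time z).
  by apply: lin_growthM; apply: lin_growth_old_time.
rewrite /time_at (mean_active nuE L2 t
  (h := fun A z => old_time (resample A z) * old_time (resample A z))).
- rewrite (_ : (fun z => _) = fun=> mean (fun z => old_time z * old_time z)); last first.
    by apply/funext => z; apply: (mean_resample nuE mu_same L2 (active t z) qs).
  by rewrite mean_cst; apply: eq_Rintegral => z _; rewrite resample0.
- by move=> A; apply: lin_growthM; apply/lin_growth_resample/lin_growth_old_time.
- by move=> A x y; rewrite !old_time_free.
Qed.

Lemma mean_ae_active0 (h : {set V} -> config -> R) :
  (forall A, measurable_fun [set: config] (h A)) ->
  measurable_fun [set: config] (fun z => h (active 0 z) z) ->
  mean (fun z => h (active 0 z) z) = mean (h finset.set0).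
Proof.
move=> mh mh0; rewrite /Rintegral; congr fine; apply: ae_eq_integral => //.
- exact/measurable_EFinP.
- exact/measurable_EFinP.
apply: filterS (ae_active0 nuE mu_clock) => z z0 _; by rewrite z0.
Qed.

Lemma mean_time_at_prod t : mean (fun z => time_at 0 z * time_at t z) =
  mean (fun z => resampled_moment nu old_time (active t z)).
Proof.
have [m0 _] := lin_growth_time_at 0; have [mt _] := lin_growth_time_at t.
rewrite (mean_ae_active0 (h := fun A z => old_time (resample A z) * time_at t z)).
- under eq_Rintegral do rewrite resample0.
  rewrite (mean_active nuE L2 t (h := fun A z => old_time z * old_time (resample A z)))//.
  - by move=> A; apply: lin_growthM; [|apply: lin_growth_resample]; apply: lin_growth_old_time.
  - move=> A x y; rewrite old_time_free.
    by have := old_time_free finset.set0 x y; rewrite !resample0 => ->.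
- by move=> A; apply: measurable_funM => //; have [] := q_old A.
- exact: measurable_funM.
Qed.

Lemma covariance_time_at s t :
  (covariance P (passage_time_at omega omega' U s) (passage_time_at omega omega' U t) =
  (mean (fun z => time_at s z * time_at t z) - mean_time ^+ 2)%:E)%E.
Proof.
have ls := lin_growth_time_at s; have lt_ := lin_growth_time_at t.
have qs := lin_quad_growth ls; have qt := lin_quad_growth lt_.
have lm := lin_growth_cst mean_time : lin_growth (fun _ : config => mean_time).
have meanE r : fine 'E_P[passage_time_at omega omega' U r] = mean_time.
  rewrite passage_time_at_environment expectation_environment /= ?mean_time_at//.
  exact/lin_quad_growth/lin_growth_time_at.
rewrite covariance.unlock !meanE !passage_time_at_environment.
have qst : quad_growth (fun z => time_at s z * time_at t z) by apply: lin_growthM.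
rewrite (_ : (_ * _)%R = (fun z => (time_at s z - mean_time) * (time_at t z - mean_time)) \o environment)//.
rewrite expectation_environment; last by apply: lin_growthM; apply: lin_growthB.
congr EFin.
rewrite (_ : (fun z => _) = fun z => time_at s z * time_at t z -
    (mean_time * time_at s z + (mean_time * time_at t z - mean_time ^+ 2))); last first.
  by apply/funext => z; ring.
have qc : quad_growth (fun _ : config => mean_time ^+ 2) by apply/lin_quad_growth/lin_growth_cst.
have q1 := quad_growthZ mean_time qs; have q2 := quad_growthZ mean_time qt.
have mc : mean (fun _ : config => mean_time ^+ 2) = mean_time ^+ 2 := mean_cst nu _.
rewrite (meanB L2)//; last by apply: quad_growthD => //; apply: quad_growthB.
rewrite (meanD L2)//; last exact: quad_growthB.
rewrite (meanB L2)// mc (meanZ L2 _ qs) (meanZ L2 _ qt) !mean_time_at; ring.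
Qed.

Lemma variance_time_at t :
  ('V_P[passage_time_at omega omega' U t] = time_variance%:E)%E.
Proof. by rewrite /variance covariance_time_at mean_time_at_sqr. Qed.

Let q_moment t : quad_growth (fun z => resampled_moment nu old_time (active t z)).
Proof. exact: (quad_growth_active_fun t (resampled_moment nu old_time)). Qed.

Let incr_moment v A := resampled_moment nu (increment v old_time) A.

Lemma stability t : 0 <= t <= 1 ->
  resampled_moment nu old_time finset.set0 -
    mean (fun z => time_at 0 z * time_at t z) <=
  t * (4 * mean (fun z => passage_time (fun v => z (old v) ^+ 2))).
Proof.
move=> t01; rewrite mean_time_at_prod.
set q0 := resampled_moment _ _ _.
have qc : quad_growth (fun _ : config => q0) by apply/lin_quad_growth/lin_growth_cst.
rewrite -[X in X - _](mean_cst nu q0) -(meanB L2 qc (q_moment t)).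
pose phi (A : {set V}) : R := \sum_v (v \in A)%:R * (2^-1 * incr_moment v finset.set0).
apply: (@le_trans _ _ (mean (fun z => phi (active t z)))).
  apply: (le_mean L2) => [||z].
  - exact: quad_growthB qc (q_moment t).
  - exact: quad_growth_active_fun.
  rewrite (le_trans (resampled_moment_drop_le nuE mu_same L2 _ _ _))//.
  - exact: lin_growth_old_time.
  - exact: no_fresh_old_time.
  rewrite /phi big_mkcond; apply: ler_sum => v _.
  by case: ifP; rewrite ?mul1r ?mul0r.
rewrite /phi (mean_sum L2); last first.
  move=> v _.
  exact: (quad_growth_active_fun t (fun A => (v \in A)%:R * (2^-1 * incr_moment v finset.set0))).
rewrite (eq_bigr (fun v => t * (2^-1 * incr_moment v finset.set0))) => [|v _]; last first.
  rewrite (mean_mem_active nuE mu_clock L2 (phi := fun=> 2^-1 * incr_moment v finset.set0))//.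
  by rewrite mean_cst.
have /andP[t0 _] := t01.
rewrite -mulr_sumr (ler_wpM2l t0)//.
exact: (sum_resampled_moment_le nuE mu_same L2).
Qed.

Lemma sum_incr_moment_le t : 0 <= t <= 1 ->
  t * \sum_v mean (fun z => incr_moment v (active t z :\ v)%SET) <= 2 * time_variance.
Proof.
move=> t01; rewrite mulr_sumr.
have vphi v A : incr_moment v (A :\ v :\ v)%SET = incr_moment v (A :\ v)%SET.
  by congr (incr_moment v _); apply/setP => u; rewrite !inE; case: eqP.
rewrite (eq_bigr (fun v => mean (fun z => (v \in active t z)%:R *
    incr_moment v (active t z :\ v)%SET))) => [|v _]; last first.
  by rewrite (mean_mem_active nuE mu_clock L2 (phi := fun A => incr_moment v (A :\ v)%SET)).
have qv v : quad_growth (fun z => (v \in active t z)%:R * incr_moment v (active t z :\ v)%SET).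
  exact: (quad_growth_active_fun t (fun A => (v \in A)%:R * incr_moment v (A :\ v)%SET)).
rewrite -(mean_sum L2 _ (fun v _ => qv v)).
have -> : 2 * time_variance = mean (fun z => 2 * time_variance) by rewrite mean_cst.
apply: (le_mean L2) => [||z].
- by apply: quad_growth_sum => v _; apply: qv.
- exact/lin_quad_growth/lin_growth_cst.
have h1 := resampled_moment_drop_ge nuE mu_same L2 (@lin_growth_old_time R d n)
  (@no_fresh_old_time _ _ _ _) (active t z).
have h2 := resampled_moment_ge_mean nuE mu_same L2 (@lin_growth_old_time R d n)
  (@no_fresh_old_time _ _ _ _) (active t z).
rewrite /time_variance /mean_time.
have -> : \sum_v (v \in active t z)%:R * incr_moment v (active t z :\ v)%SET =
    2 * \sum_(v in active t z) 2^-1 * incr_moment v (active t z :\ v)%SET.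
  rewrite mulr_sumr [RHS]big_mkcond; apply: eq_bigr => v _.
  by case: ifP => _; rewrite ?mul0r// mul1r; field.
by rewrite ler_wpM2l// (le_trans h1)// lerB.
Qed.

Lemma mean_common_geodesic_sites t :
  ('E_P[fun x => (#|(geodesic_sites_at omega omega' U 0%R x :&:
      geodesic_sites_at omega omega' U t x)%SET|%:R : R)] =
  (\sum_v mean (fun z => mean (fun z' => (common_geodesic_site v (active t z) z')%:R)))%:E)%E.
Proof.
pose g v (A B : {set V}) (z : config) : R :=
  (v \in old_geodesic_sites (resample A z))%:R * (v \in old_geodesic_sites (resample B z))%:R.
have qgeo v A : quad_growth (fun z : config => (v \in old_geodesic_sites (resample A z))%:R : R).
  apply: (quad_growth_resample A (h := fun z => (v \in old_geodesic_sites z)%:R)).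
  apply: quad_growth_bool.
  apply: (@measurable_mem_geodesic_sites _ _ _ _ config (fun v z => z (old v))) => u.
  exact: measurable_coord.
have qat (v : V) s : quad_growth (fun z : config => (v \in old_geodesic_sites (resample (active s z) z))%:R : R).
  apply: (quad_growth_active s (h := fun A z => (v \in old_geodesic_sites (resample A z))%:R)).
  by move=> A; apply: qgeo.
have qg0 v : quad_growth (fun z => g v (active 0 z) (active t z) z).
  apply: (quad_growth_bounded (a := 1)) => //; first by have [] := qat v 0.
  by move=> z; case: (_ \in _); rewrite ?normr1 ?normr0.
pose h z := \sum_v g v (active 0 z) (active t z) z.
rewrite (_ : (fun x => _) = h \o environment); last first.
  apply/funext => x; rewrite /h /= -sum1_card natr_sum big_mkcond; apply: eq_bigr => v _.
  have e s : geodesic_sites_at omega omega' U s x =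
      old_geodesic_sites (resample (active s (environment x)) (environment x)).
    by congr geodesic_sites; apply/funext => u; rewrite -resample_active.
  rewrite inE !e /g; by do 2 case: (v \in _); rewrite ?mulr0 ?mulr1.
rewrite expectation_environment; last exact: quad_growth_sum.
congr EFin; rewrite /h (mean_sum L2 _ (fun v _ => qg0 v)); apply: eq_bigr => v _.
rewrite (mean_ae_active0 (h := fun A z => g v A (active t z) z)).
- rewrite -(mean_active nuE L2 t (h := fun A z => (common_geodesic_site v A z)%:R)).
  + apply: eq_Rintegral => z _; rewrite /g /common_geodesic_site resample0.
    by do 2 case: (v \in _); rewrite ?mulr0 ?mulr1.
  + by move=> A; apply: quad_growth_bool; apply: measurable_common_geodesic_site.
  + move=> A x y; congr (nat_of_bool (_ && _))%:R; congr (v \in geodesic_sites _);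
      apply/funext => u.
    * by rewrite /merge /clocks inE.
    * by rewrite /resample /reindex_config /merge /=; case: (u \in A); rewrite /clocks inE.
- by move=> A; apply: measurable_funM; [have [] := qgeo v A|have [] := qat v t].
- by have [] := qg0 v.
Qed.

Lemma chaos t c : 0 < c ->
  (forall m b : R, (c%:E * F `[m, +oo[%classic <=
    \int[F]_x ((Num.max 0 (x - m) - b) ^+ 2)%:E)%E) ->
  0 < t <= 1 ->
  ('E_P[fun x => (#|(geodesic_sites_at omega omega' U 0%R x :&:
      geodesic_sites_at omega omega' U t x)%SET|%:R : R)] <=
   (2 / c * (time_variance / t))%:E)%E.
Proof.
move=> c0 F_var /andP[t0 t1]; rewrite mean_common_geodesic_sites lee_fin.
have t01 : 0 <= t <= 1 by rewrite ltW.
rewrite mulf_div ler_pdivlMr ?mulr_gt0// mulrC -mulrA.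
apply: le_trans (sum_incr_moment_le t01); rewrite mulrCA ler_wpM2l ?(ltW t0)//.
rewrite mulr_sumr; apply: ler_sum => v _.
have qA : quad_growth (fun z => mean (fun z' => (common_geodesic_site v (active t z) z')%:R)).
  exact: (quad_growth_active_fun t (fun A => mean (fun z' => (common_geodesic_site v A z')%:R))).
rewrite -(meanZ L2)//; apply: (le_mean L2) => [||z].
- exact: quad_growthZ.
- exact: (quad_growth_active_fun t (fun A => incr_moment v (A :\ v)%SET)).
by apply: (common_geodesic_site_le nuE _ _ F_L2 F_var) => //; apply: ltW.
Qed.

End Dynamics.

Theorem theorem1p1 (R : realType) (d : nat) (d_ge2 : (2 <= d)%N)
    (F : probability (measurableTypeR R) R)
    (F_nonneg : F `[0, +oo[%classic = 1%E)
    (F_nondegenerate : forall a : R, F [set a] <> 1%E)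
    (F_tail : (\int[lebesgue_measure]_(x in `[0%R, +oo[)
       ((1 - distribution_function F (Num.sqrt x)) `^ (d%:R^-1))%:E < +oo)%E) :
  exists C : R,
    forall (n : nat), (1 <= n)%N ->
    forall (disp : measure_display) (Omega : measurableType disp)
      (P : probability Omega R) (omega omega' U : site d n -> {RV P >-> R}),
    dynamic_environment omega omega' U F ->
    let T := passage_time_at omega omega' U in
    let geo := geodesic_sites_at omega omega' U in
    let varT := fine ('V_P[T 0%R])%E in
    forall alpha : R, 0 < alpha -> alpha < n%:R / varT ->
      (forall t : R, 0 <= t <= 1 -> t <= alpha * n%:R^-1 * varT ->
         1 - C * alpha <= correlation P (T 0) (T t))
      /\
      ((exists2 c : R, 0 < c &
          forall k : R, 0 <= k ->
            (0 < F `]k, +oo[%classic)%E /\ (c%:E < variance_above F k)%E) ->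
       forall t : R, 0 <= t <= 1 -> alpha * n%:R^-1 * varT <= t ->
         ('E_P[fun x => (#|(geo 0%R x :&: geo t x)%SET|%:R : R)]
            <= (C * (n%:R / alpha))%:E)%E).
Proof.
have d_gt0 : (0 < d)%N by apply: leq_trans d_ge2.
have [M M0 M_ge] := sum_upper_tail_root F_tail.
have F_L2 := second_moment_lty F_nonneg d_gt0 F_tail.
pose A : R := 4 * (d%:R * d.+2%:R / ln 2 * M).
have A0 : 0 <= A by rewrite !mulr_ge0// invr_ge0 ln_ge0// ler1n.
have [B B0 chaotic] : exists2 B : R, 0 <= B &
    (exists2 c : R, 0 < c & forall k : R, 0 <= k ->
       (0 < F `]k, +oo[%classic)%E /\ (c%:E < variance_above F k)%E) ->
    exists2 c : R, 0 < c & 2 / c = B /\ forall m b : R, (c%:E * F `[m, +oo[%classic <=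
      \int[F]_x ((Num.max 0 (x - m) - b) ^+ 2)%:E)%E.
  have [[c0 c0_gt0 F_above]|no] := pselect (exists2 c : R, 0 < c & forall k : R, 0 <= k ->
       (0 < F `]k, +oo[%classic)%E /\ (c%:E < variance_above F k)%E); last by exists 0.
  have [c c_gt0 F_var] := positive_part_sqr_dist F_L2 c0_gt0 F_above.
  by exists (2 / c) => [|_]; [rewrite divr_ge0// ltW|exists c].
exists (A + B) => n n_gt0 disp Omega P omega omega' U env T geo varT alpha alpha_gt0 alpha_lt.
have n_pos : 0 < n%:R :> R by rewrite ltr0n.
pose v := time_variance omega omega' U.
have varE (t : R) : ('V_P[T t] = v%:E)%E := variance_time_at env F_L2 t.
have varTE : varT = v by rewrite /varT varE.
have v_gt0 : 0 < v.
  have : 0 < n%:R / varT by apply: lt_trans alpha_lt.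
  by rewrite varTE pmulr_rgt0// invr_gt0.
rewrite varTE; split => [t t01 t_le|F_above t /andP[t0 t1] t_ge].
- rewrite /correlation !varE /= -expr2 sqr_sqrtr ?(ltW v_gt0)// (covariance_time_at env F_L2) /=.
  rewrite ler_pdivlMr//.
  have := stability env F_L2 t01.
  set q0 := resampled_moment _ _ _; set q := (\int[_]_z _)%R; set m := (\int[_]_z _)%R.
  have m_le : 4 * m <= A * n%:R.
    rewrite /A -[leRHS]mulrA ler_wpM2l//.
    by apply: (mean_passage_time_sqr d_gt0 n_gt0 (environment_lawE env) _ _ F_L2 F_nonneg M_ge).
  have vE : v = q0 - mean_time omega omega' U ^+ 2 by [].
  have t_m : t * (4 * m) <= alpha * v * A.
    apply: (le_trans (ler_wpM2l _ m_le)); first by case/andP: t01.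
    apply: (le_trans (ler_wpM2r _ t_le)); first by rewrite mulr_ge0// ltW.
    by rewrite le_eqVlt; apply/orP; left; apply/eqP; field; rewrite gt_eqF.
  have vB : 0 <= alpha * v * B by rewrite !mulr_ge0// ltW.
  move=> h; lra.
- have [c c_gt0 [cB F_var]] := chaotic F_above.
  have t_gt0 : 0 < t by apply: lt_le_trans t_ge; rewrite !mulr_gt0// invr_gt0.
  apply: (le_trans (chaos env F_L2 c_gt0 F_var _)); first by rewrite t_gt0.
  have vt : v / t <= n%:R / alpha.
    rewrite ler_pdivrMr// mulrAC ler_pdivlMr// [n%:R * _]mulrC -ler_pdivrMr//.
    by rewrite [v * _]mulrC mulrAC.
  have nA : 0 <= n%:R / alpha by rewrite divr_ge0// ltW.
  by rewrite lee_fin cB; apply: ler_pM => //; rewrite ?lerDr// divr_ge0// ltW.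
Qed.
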